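(* Let $a>0$, let $\Lambda=\{(2\pi\tilde k a,\,2\pi\tilde l a): \tilde k,\tilde l\in\mathbb{Z}\}\subset\mathbb{R}^2$, and let $T^2=\mathbb{R}^2/\Lambda$ be the square torus with the flat metric induced from $\mathbb{R}^2$. Then: (a) $T^2$ admits a (full, isometric) proper-biharmonic immersion into the unit sphere $\mathbb{S}^n$, with $n\equiv 3\pmod 4$, with constant mean curvature $h\in(0,1)$ if and only if $$4a^2=p_1^2+q_1^2+p_2^2+q_2^2,\qquad h=\frac{p_2^2+q_2^2-p_1^2-q_1^2}{p_1^2+q_1^2+p_2^2+q_2^2},$$ and $$7\le n\le r_2(p_1^2+q_1^2)+r_2(p_2^2+q_2^2)-1,$$ for some $p_1,q_1,p_2,q_2\in\mathbb{N}$ with $0<p_1^2+q_1^2<p_2^2+q_2^2$. (b) If $4a^2=p^2+q^2$ with $p,q\in\mathbb{N}$, $0<p<q$, then $T^2$ admits a (full, isometric) CMC proper-biharmonic immersion into $\mathbb{S}^n$ with mean curvature $h=(q^2-p^2)/(p^2+q^2)$ for every odd $n$ with $5\le n\le r_2(p^2)+r_2(q^2)-1$.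
   Context: For $p\in\mathbb{N}$, $r_2(p)$ denotes the number of representations of $p$ as a sum of two squares of integers, i.e. the number of pairs $(x,y)\in\mathbb{Z}^2$ with $x^2+y^2=p$. A map $\phi:(M,g)\to(N,\tilde g)$ between Riemannian manifolds is biharmonic if it is a critical point of the bienergy $E_2(\phi)=\frac12\int_M|\tau(\phi)|^2v_g$, equivalently if $\tau_2(\phi)=-\Delta\tau(\phi)-\operatorname{trace}R^N(d\phi,\tau(\phi))d\phi=0$, where $\tau(\phi)$ is the tension field; it is proper-biharmonic if biharmonic but not harmonic. For an isometric immersion of a surface the mean curvature is $h=|H|$; CMC means $h$ is constant. Immersions are isometric and full, i.e. their image does not lie in any totally geodesic sphere $\mathbb{S}^{n'}\subset\mathbb{S}^n$ with $n'<n$. $\mathbb{N}$ includes $0$. *)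

(* Defs.v *)
From Stdlib Require Import Reals ZArith List Arith.
From Coquelicot Require Import Coquelicot.
Open Scope R_scope.

(* r2 p = #{(x,y) in Z^2 | x^2 + y^2 = p}.  Every solution satisfies
   |x|,|y| <= p, so it suffices to enumerate the box [-p,p]^2. *)
Definition zrange (p : nat) : list Z :=
  map (fun k => (Z.of_nat k - Z.of_nat p)%Z) (seq 0 (2 * p + 1)).
Definition r2 (p : nat) : nat :=
  length (filter (fun xy : Z * Z => Z.eqb (fst xy * fst xy + snd xy * snd xy)%Z (Z.of_nat p))
                 (list_prod (zrange p) (zrange p))).

(* A map R^2 -> R^(n+1): F x y i is the i-th coordinate (only i <= n matters). *)
Definition vfun := R -> R -> nat -> R.

Definition dot (n : nat) (u v : nat -> R) : R := sum_f_R0 (fun i => u i * v i) n.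

Definition dX (F : vfun) : vfun := fun x y i => Derive (fun t => F t y i) x.
Definition dY (F : vfun) : vfun := fun x y i => Derive (fun t => F x t i) y.

Fixpoint iterD (w : list bool) (F : vfun) : vfun :=
  match w with
  | nil => F
  | b :: w' => (if b then dX else dY) (iterD w' F)
  end.

Definition smooth_on (n : nat) (F : vfun) : Prop :=
  forall (w : list bool) (i : nat), (i <= n)%nat -> forall x y : R,
    ex_derive (fun t => iterD w F t y i) x /\
    ex_derive (fun t => iterD w F x t i) y /\
    continuous (fun p : R * R => iterD w F (fst p) (snd p) i) (x, y).

(* Lambda-periodic, Lambda = 2 pi a Z^2: F descends to T^2 = R^2 / Lambda *)
Definition lattice_periodic (a : R) (n : nat) (F : vfun) : Prop :=
  forall x y i, (i <= n)%nat ->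
    F (x + 2 * PI * a) y i = F x y i /\ F x (y + 2 * PI * a) i = F x y i.

Definition into_unit_sphere (n : nat) (F : vfun) : Prop :=
  forall x y, dot n (F x y) (F x y) = 1.

Definition isometric (n : nat) (F : vfun) : Prop :=
  forall x y, dot n (dX F x y) (dX F x y) = 1 /\ dot n (dX F x y) (dY F x y) = 0
              /\ dot n (dY F x y) (dY F x y) = 1.

(* full: the image lies in no totally geodesic S^{n'} (n' < n), i.e. in no
   linear hyperplane of R^(n+1) *)
Definition full (n : nat) (F : vfun) : Prop :=
  forall c : nat -> R, (forall x y, dot n c (F x y) = 0) ->
    forall i, (i <= n)%nat -> c i = 0.

Definition torus_immersion (a : R) (n : nat) (F : vfun) : Prop :=
  smooth_on n F /\ lattice_periodic a n F /\ into_unit_sphere n F /\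
  isometric n F /\ full n F.

Definition tproj (n : nat) (F V : vfun) : vfun :=
  fun x y i => V x y i - dot n (V x y) (F x y) * F x y i.

Definition lap (F : vfun) : vfun := fun x y i => dX (dX F) x y i + dY (dY F) x y i.

(* tension field tau(F) = trace nabla dF = tangential part of the Euclidean Laplacian *)
Definition tension (n : nat) (F : vfun) : vfun := tproj n F (lap F).

(* pull-back Levi-Civita connection of S^n along F, in directions d/dx, d/dy *)
Definition connX (n : nat) (F V : vfun) : vfun := tproj n F (dX V).
Definition connY (n : nat) (F V : vfun) : vfun := tproj n F (dY V).

(* trace R^{S^n}(dF, V) dF, with R(X,Y)Z = <Y,Z>X - <X,Z>Y on the unit sphere,
   traced over the orthonormal frame d/dx, d/dy of the flat torus *)
Definition curv_trace (n : nat) (F V : vfun) : vfun :=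
  fun x y i =>
    (dot n (V x y) (dX F x y) * dX F x y i - dot n (dX F x y) (dX F x y) * V x y i)
  + (dot n (V x y) (dY F x y) * dY F x y i - dot n (dY F x y) (dY F x y) * V x y i).

(* bitension tau_2(F) = -Delta tau - trace R(dF,tau)dF, where
   -Delta = trace nabla^2 = nabla_x nabla_x + nabla_y nabla_y (flat parallel frame) *)
Definition bitension (n : nat) (F : vfun) : vfun :=
  fun x y i =>
    connX n F (connX n F (tension n F)) x y i + connY n F (connY n F (tension n F)) x y i
    - curv_trace n F (tension n F) x y i.

Definition harmonic (n : nat) (F : vfun) : Prop :=
  forall x y i, (i <= n)%nat -> tension n F x y i = 0.
Definition biharmonic (n : nat) (F : vfun) : Prop :=
  forall x y i, (i <= n)%nat -> bitension n F x y i = 0.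
Definition proper_biharmonic (n : nat) (F : vfun) : Prop :=
  biharmonic n F /\ ~ harmonic n F.

(* mean curvature vector H = (1/2) trace B, B the second fundamental form of the
   surface in S^n: normal part (orthogonal to F, F_x, F_y) of the second derivatives;
   uses that F_x, F_y are orthonormal (isometric immersion). *)
Definition mean_curv_vec (n : nat) (F : vfun) : vfun :=
  fun x y i =>
    / 2 * (lap F x y i - dot n (lap F x y) (F x y) * F x y i
           - dot n (lap F x y) (dX F x y) * dX F x y i
           - dot n (lap F x y) (dY F x y) * dY F x y i).

Definition mean_curv (n : nat) (F : vfun) (x y : R) : R :=
  sqrt (dot n (mean_curv_vec n F x y) (mean_curv_vec n F x y)).

Definition admits_pbh_cmc (a : R) (n : nat) (h : R) : Prop :=
  exists F : vfun, torus_immersion a n F /\ proper_biharmonic n F /\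
    forall x y, mean_curv n F x y = h.

(* Main.v *)
Require Import Defs.
From Stdlib Require Import Reals ZArith List Arith.
From Coquelicot Require Import Coquelicot.
From Stdlib Require Import Lia Lra FinFun Classical FunctionalExtensionality.
Open Scope R_scope.

(** Put [T = lap F + 2 F].  For an isometric immersion of the flat torus into the sphere [T] is
    the tension field, it is normal, and biharmonicity with [|H| = h] constant reads
    [lap T = 4 h^2 F - 2 T].  Hence [T + 2 h F] and [T - 2 h F] are eigenmaps of the flat
    Laplacian with eigenvalues [2 (1 - h)] and [2 (1 + h)], which must be [N1 / a^2] and
    [N2 / a^2] with [N1], [N2] sums of two squares; the coordinates of [F] lie in the sum of the
    two eigenspaces, of dimension [r2 N1 + r2 N2], and fullness gives the bound on [n].  The
    value [n = 3] is excluded by the Gauss equation.  Conversely, a quarter-turn orbit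
    [{v, v^perp}] of frequencies with equal weights induces a multiple of the flat metric, so any
    choice of orbits on the two circles [|v|^2 = N1], [|v|^2 = N2], each circle with total weight
    1/2, gives an immersion; for [n = 1 mod 4] a lone frequency [(p, 0)] is balanced
    by extra weight at [(0, q)]. *)

(** * Linear algebra and representations as sums of two squares *)

(** The eigenvalues [2 (1 - h)] and [2 (1 + h)] add up to 4, whence [4 a^2 = N1 + N2], and their
    difference gives [h]. A frequency modulo sign yields two coordinates, a cosine and a sine, so a
    full circle of frequencies contributes [r2 N] coordinates and a quarter-turn orbit exactly four;
    hence the role of [n] modulo 4. The weight 1/2 of each circle is forced by the trace of the
    induced metric. In the necessity part no Fourier expansion is formed. It suffices that a
    continuous periodic function with vanishing Fourier coefficients is zero: each coefficient in
    [y] of an eigenfunction solves a linear second-order equation in [x], is determined by its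
    initial data, and periodicity leaves one datum per lattice point of the circle. The bound on [n]
    is then a count of equations against unknowns. *)

Definition skip (p i : nat) : nat := if (i <? p)%nat then i else S i.

Lemma sum_skip (f : nat -> R) (p n : nat) : (p <= S n)%nat ->
  sum_f_R0 f (S n) = f p + sum_f_R0 (fun i => f (skip p i)) n.
Proof.
  assert (Hlast : forall g m, sum_f_R0 g (S m) =
                  g (S m) + sum_f_R0 (fun i => g (skip (S m) i)) m).
  { intros g m. simpl. rewrite Rplus_comm. f_equal. apply sum_eq. intros i Hi.
    unfold skip. destruct (Nat.ltb_spec i (S m)); [reflexivity | lia]. }
  induction n as [|n IH]; intros Hp.
  - destruct p as [|p]; [reflexivity|]. replace (S p) with 1%nat by lia. apply Hlast.
  - destruct (Nat.eq_dec p (S (S n))) as [->|]; [apply Hlast|].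
    change (sum_f_R0 f (S (S n))) with (sum_f_R0 f (S n) + f (S (S n))).
    rewrite IH by lia.
    change (sum_f_R0 (fun i => f (skip p i)) (S n))
      with (sum_f_R0 (fun i => f (skip p i)) n + f (skip p (S n))).
    replace (skip p (S n)) with (S (S n)); [ring|].
    unfold skip. destruct (Nat.ltb_spec (S n) p); [lia | reflexivity].
Qed.

(** There are [n + 1] unknowns for [m <= n] equations. Gaussian elimination on the last row: a pivot
    column [p] is removed from the other rows and recovered by back substitution; a zero row imposes
    nothing. *)
Lemma exists_nontrivial_kernel (m n : nat) (M : nat -> nat -> R) : (m <= n)%nat ->
  exists c : nat -> R, (exists i, (i <= n)%nat /\ c i <> 0) /\
    forall j, (j < m)%nat -> sum_f_R0 (fun i => M j i * c i) n = 0.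
Proof.
  revert n M. induction m as [|m IH]; intros n M Hmn.
  { exists (fun _ => 1). split; [exists 0%nat; split; [lia | lra] | intros; lia]. }
  destruct (classic (exists p, (p <= n)%nat /\ M m p <> 0)) as [[p [Hp Hpz]]|Hz].
  - destruct n as [|n]; [lia|].
    destruct (IH n (fun j i => M j (skip p i) - M j p * (M m (skip p i) / M m p)))
      as [c [[i0 [Hi0 Hc0]] Hc]]; [lia|].
    (* [c0] solves the pivot row for the unknown [p]; [d] inserts it at position [p]. *)
    set (c0 := - sum_f_R0 (fun i => M m (skip p i) / M m p * c i) n).
    set (d := fun j => if Nat.eq_dec j p then c0
                       else if (j <? p)%nat then c j else c (j - 1)%nat).
    assert (Hdp : d p = c0) by (unfold d; destruct (Nat.eq_dec p p); congruence).
    assert (Hds : forall i, d (skip p i) = c i).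
    { intros i. unfold d, skip.
      destruct (Nat.ltb_spec i p).
      - destruct (Nat.eq_dec i p); [lia|]. destruct (Nat.ltb_spec i p); [reflexivity|lia].
      - destruct (Nat.eq_dec (S i) p); [lia|]. destruct (Nat.ltb_spec (S i) p); [lia|].
        f_equal; lia. }
    exists d. split.
    + exists (skip p i0). split; [unfold skip; destruct (i0 <? p)%nat; lia|].
      now rewrite Hds.
    + intros j Hj. rewrite (sum_skip _ p) by lia. rewrite Hdp.
      rewrite (sum_eq _ (fun i => M j (skip p i) * c i)) by (intros; now rewrite Hds).
      destruct (Nat.eq_dec j m) as [->|Hjm].
      * unfold c0.
        rewrite (sum_eq (fun i => M m (skip p i) * c i)
                   (fun i => (M m (skip p i) / M m p * c i) * M m p))
          by (intros; field; auto).
        rewrite <- scal_sum. ring.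
      * assert (Hj' := Hc j ltac:(lia)). unfold c0.
        rewrite (sum_eq _ (fun i => M j (skip p i) * c i
                   + (M m (skip p i) / M m p * c i) * - M j p)) in Hj'
          by (intros; ring).
        rewrite plus_sum, <- scal_sum in Hj'. lra.
  - destruct (IH n M) as [c [Hc0 Hc]]; [lia|].
    exists c. split; auto. intros j Hj.
    destruct (Nat.eq_dec j m) as [->|]; [|apply Hc; lia].
    rewrite (sum_eq _ (fun _ => 0)).
    + rewrite sum_cte. ring.
    + intros i Hi. replace (M m i) with 0; [ring|].
      apply NNPP. intros H. apply Hz. exists i; split; auto.
Qed.

(** The list whose length is [r2 p] by conversion; its elements later index the Fourier modes. *)
Definition reps (p : nat) : list (Z * Z) :=
  filter (fun xy : Z * Z => Z.eqb (fst xy * fst xy + snd xy * snd xy)%Z (Z.of_nat p))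
         (list_prod (zrange p) (zrange p)).

Lemma in_zrange (p : nat) (z : Z) : (- Z.of_nat p <= z <= Z.of_nat p)%Z -> In z (zrange p).
Proof.
  intros H. unfold zrange. apply in_map_iff. exists (Z.to_nat (z + Z.of_nat p)).
  split; [lia|]. apply in_seq. lia.
Qed.

Lemma in_reps (p : nat) (x y : Z) : In (x, y) (reps p) <-> (x * x + y * y = Z.of_nat p)%Z.
Proof.
  unfold reps. rewrite filter_In. simpl. rewrite Z.eqb_eq. split; [tauto|].
  intros H. split; auto. apply in_prod; apply in_zrange; nia.
Qed.

Lemma NoDup_list_prod {A B : Type} (l : list A) (l' : list B) :
  NoDup l -> NoDup l' -> NoDup (list_prod l l').
Proof.
  intros Hl Hl'. induction Hl as [|x l Hx Hl IH]; simpl; [constructor|].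
  apply NoDup_app; auto.
  - apply Injective_map_NoDup; auto. intros u v Huv. congruence.
  - intros [u v] Hu Hv. apply in_map_iff in Hu. destruct Hu as [w [Hw _]].
    apply in_prod_iff in Hv. injection Hw as -> ->. tauto.
Qed.

Lemma NoDup_reps (p : nat) : NoDup (reps p).
Proof.
  assert (Hz : NoDup (zrange p)).
  { unfold zrange. apply Injective_map_NoDup; [|apply seq_NoDup].
    intros u v Huv. lia. }
  now apply NoDup_filter, NoDup_list_prod.
Qed.

Definition rot (v : Z * Z) : Z * Z := ((- snd v)%Z, fst v).

(** A fundamental domain for quarter turns on the nonzero lattice points of the circle: one element
    stands for an orbit of four. *)
Definition quad (p : nat) : list (Z * Z) :=
  filter (fun v => ((0 <? fst v) && (0 <=? snd v))%Z%bool) (reps p).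

Lemma in_quad (p : nat) (x y : Z) :
  In (x, y) (quad p) <-> (0 < x /\ 0 <= y /\ x * x + y * y = Z.of_nat p)%Z.
Proof.
  unfold quad. rewrite filter_In, in_reps. simpl.
  rewrite Bool.andb_true_iff, Z.ltb_lt, Z.leb_le. tauto.
Qed.

Lemma NoDup_quad (p : nat) : NoDup (quad p).
Proof. apply NoDup_filter, NoDup_reps. Qed.

(* Every nonzero integer vector is a quarter-turn rotation of a unique one in the
   half-open first quadrant. *)
Lemma r2_le_quad (p : nat) (l : list (Z * Z)) : (0 < p)%nat ->
  (forall v, In v (quad p) -> In v l) -> (r2 p <= 4 * length l)%nat.
Proof.
  intros Hp Hl.
  set (l1 := map rot l). set (l2 := map rot l1). set (l3 := map rot l2).
  assert (Hlen : length (l ++ l1 ++ l2 ++ l3) = (4 * length l)%nat).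
  { unfold l3, l2, l1. rewrite !length_app, !length_map. lia. }
  rewrite <- Hlen. change (r2 p) with (length (reps p)).
  apply NoDup_incl_length; [apply NoDup_reps|].
  intros [x y] H. apply in_reps in H.
  assert (Hr : forall u v m, In (u, v) m -> In ((- v)%Z, u) (map rot m)).
  { intros u v m Hm. apply in_map_iff. exists (u, v). auto. }
  rewrite !in_app_iff.
  destruct (Z_lt_le_dec 0 x) as [Hx|Hx]; destruct (Z_lt_le_dec 0 y) as [Hy|Hy].
  - left. apply Hl, in_quad. lia.
  - destruct (Z.eq_dec y 0) as [->|Hy0]; [left; apply Hl, in_quad; lia|].
    do 3 right. unfold l3, l2, l1.
    replace (x, y) with ((- - x)%Z, (- - y)%Z) by (f_equal; lia).
    apply Hr. replace (- - y)%Z with y by lia.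
    replace y with (- - y)%Z by lia. apply Hr. apply Hr. apply Hl, in_quad. lia.
  - right; left. replace x with (- - x)%Z by lia. apply Hr, Hl, in_quad. lia.
  - destruct (Z.eq_dec x 0) as [->|Hx0].
    + do 3 right. unfold l3, l2, l1. change (0, y)%Z with ((- 0)%Z, y). apply Hr.
      replace y with (- - y)%Z by lia. apply Hr. change (0, - y)%Z with ((- 0)%Z, (- y)%Z). apply Hr.
      apply Hl, in_quad. nia.
    + right; right; left. unfold l2, l1. replace x with (- - x)%Z by lia. apply Hr.
      replace y with (- - y)%Z by lia. apply Hr. apply Hl, in_quad. lia.
Qed.

(** * Immersions by trigonometric waves *)

(* Coordinates [2j] and [2j+1] are the cosine and the sine of the [j]-th frequency
   [(kap j, lam j)]; the phase shift [s] absorbs derivatives. *)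
Definition wave (kap lam wt c : nat -> R) (s : R) : vfun := fun x y i =>
  let j := (i / 2)%nat in
  c j * (sqrt (wt j) * cos (kap j * x + lam j * y - INR (i mod 2) * (PI / 2) + s)).

Lemma dX_wave kap lam wt c s :
  dX (wave kap lam wt c s) = wave kap lam wt (fun j => c j * kap j) (s + PI / 2).
Proof.
  extensionality x. extensionality y. extensionality i. unfold dX, wave.
  apply is_derive_unique. set (j := (i / 2)%nat). set (e := INR (i mod 2) * (PI / 2)).
  auto_derive; auto.
  replace (kap j * x + lam j * y - e + (s + PI / 2))
    with (PI / 2 + (kap j * x + lam j * y - e + s)) by ring.
  rewrite cos_plus, cos_PI2, sin_PI2. unfold Rminus. ring.
Qed.

Lemma dY_wave kap lam wt c s :
  dY (wave kap lam wt c s) = wave kap lam wt (fun j => c j * lam j) (s + PI / 2).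
Proof.
  extensionality x. extensionality y. extensionality i. unfold dY, wave.
  apply is_derive_unique. set (j := (i / 2)%nat). set (e := INR (i mod 2) * (PI / 2)).
  auto_derive; auto.
  replace (kap j * x + lam j * y - e + (s + PI / 2))
    with (PI / 2 + (kap j * x + lam j * y - e + s)) by ring.
  rewrite cos_plus, cos_PI2, sin_PI2. unfold Rminus. ring.
Qed.

Lemma wave_plus_PI kap lam wt c s x y i :
  wave kap lam wt c (s + PI / 2 + PI / 2) x y i = - wave kap lam wt c s x y i.
Proof.
  unfold wave.
  match goal with |- _ * (_ * cos ?u) = - (_ * (_ * cos ?v)) =>
    replace u with (v + PI) by field end.
  rewrite neg_cos. ring.
Qed.

Lemma iterD_wave kap lam wt w c s :
  exists c' s', iterD w (wave kap lam wt c s) = wave kap lam wt c' s'.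
Proof.
  induction w as [|b w [c' [s' IH]]]; [now exists c, s|].
  simpl. rewrite IH. destruct b; [rewrite dX_wave | rewrite dY_wave]; eauto.
Qed.

Lemma wave_smooth n kap lam wt c s : smooth_on n (wave kap lam wt c s).
Proof.
  intros w i _ x y. destruct (iterD_wave kap lam wt w c s) as [c' [s' ->]].
  unfold wave. repeat split; [auto_derive; auto | auto_derive; auto |].
  set (j := (i / 2)%nat).
  apply (continuous_mult (K := R_AbsRing) (fun _ => c' j)); [apply continuous_const|].
  apply (continuous_mult (K := R_AbsRing) (fun _ => sqrt (wt j))); [apply continuous_const|].
  apply continuous_comp; [|apply continuous_cos].
  apply (continuous_plus (V := R_NormedModule)); [|apply continuous_const].
  apply (continuous_minus (V := R_NormedModule)); [|apply continuous_const].
  apply (continuous_plus (V := R_NormedModule)).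
  - apply (continuous_mult (K := R_AbsRing) (fun _ => kap j)); [apply continuous_const|].
    apply continuous_fst.
  - apply (continuous_mult (K := R_AbsRing) (fun _ => lam j)); [apply continuous_const|].
    apply continuous_snd.
Qed.

Lemma sum_pairs (g : nat -> R) (m : nat) :
  sum_f_R0 g (2 * m + 1) = sum_f_R0 (fun j => g (2 * j)%nat + g (2 * j + 1)%nat) m.
Proof.
  induction m as [|m IH]; [reflexivity|].
  replace (2 * S m + 1)%nat with (S (S (2 * m + 1))) by lia.
  rewrite !tech5, IH.
  replace (2 * S m)%nat with (S (2 * m + 1)) by lia.
  replace (S (2 * m + 1) + 1)%nat with (S (S (2 * m + 1))) by lia. ring.
Qed.

Lemma double_div2 j : ((2 * j) / 2 = j /\ (2 * j + 1) / 2 = j /\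
  (2 * j) mod 2 = 0 /\ (2 * j + 1) mod 2 = 1)%nat.
Proof.
  repeat split.
  - rewrite Nat.mul_comm, Nat.div_mul; lia.
  - symmetry. apply Nat.div_unique with 1%nat; lia.
  - rewrite Nat.mul_comm. apply Nat.Div0.mod_mul.
  - symmetry. apply Nat.mod_unique with j; lia.
Qed.

(** In each coordinate pair [cos u cos v + sin u sin v = cos (u - v)], so the base point drops out:
    inner products of derivatives of the map become constants, weighted sums over the
    frequencies. *)
Lemma dot_wave m kap lam wt c d s t x y : (forall j, (j <= m)%nat -> 0 <= wt j) ->
  dot (2 * m + 1) (wave kap lam wt c s x y) (wave kap lam wt d t x y)
  = cos (s - t) * sum_f_R0 (fun j => c j * d j * wt j) m.
Proof.
  intros Hw. unfold dot. rewrite sum_pairs, scal_sum. apply sum_eq. intros j Hj.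
  unfold wave. destruct (double_div2 j) as [-> [-> [-> ->]]].
  set (th := kap j * x + lam j * y).
  replace (th - INR 0 * (PI / 2) + s) with (th + s) by (simpl; ring).
  replace (th - INR 0 * (PI / 2) + t) with (th + t) by (simpl; ring).
  replace (th - INR 1 * (PI / 2) + s) with (- (PI / 2 - (th + s))) by (simpl; ring).
  replace (th - INR 1 * (PI / 2) + t) with (- (PI / 2 - (th + t))) by (simpl; ring).
  rewrite !cos_neg, !cos_shift.
  replace (s - t) with (th + s - (th + t)) by ring.
  rewrite (cos_minus (th + s) (th + t)).
  rewrite <- (sqrt_sqrt (wt j)) at 5 by auto. ring.
Qed.

Lemma wave_periodic a m kap lam wt c s (k l : nat -> Z) : 0 < a ->
  (forall j, kap j = IZR (k j) / a) -> (forall j, lam j = IZR (l j) / a) ->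
  lattice_periodic a m (wave kap lam wt c s).
Proof.
  assert (Hp : forall z u, cos (u + 2 * IZR z * PI) = cos u).
  { intros z u. destruct (Z_le_gt_dec 0 z).
    - rewrite <- (Z2Nat.id z) by lia. rewrite <- INR_IZR_INZ. apply cos_period.
    - rewrite <- (cos_period (u + 2 * IZR z * PI) (Z.to_nat (- z))).
      rewrite INR_IZR_INZ, Z2Nat.id, opp_IZR by lia. f_equal. ring. }
  intros Ha Hk Hl x y i _. unfold wave. rewrite Hk, Hl. set (j := (i / 2)%nat).
  split; do 2 f_equal; symmetry.
  - rewrite <- (Hp (k j)). f_equal. field. lra.
  - rewrite <- (Hp (l j)). f_equal. field. lra.
Qed.

(** The hypothesis says that the two vectors differ even up to sign, since the three quadratic
    monomials determine a vector up to sign. If a square differs, a shift along that axis suffices;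
    otherwise [(k', l')] is a mirror image of [(k, l)] in a coordinate axis. *)
Lemma separating_shift (k l k' l' : R) : k * k <> k' * k' \/ l * l <> l' * l' \/ k * l <> k' * l' ->
  exists s t, cos (k * s + l * t) <> cos (k' * s + l' * t).
Proof.
  assert (H1 : forall u v, u * u < v * v -> exists s, cos (u * s) <> cos (v * s)).
  { intros u v Huv.
    assert (Hv : 0 < Rabs v).
    { apply Rabs_pos_lt. intros ->. nra. }
    assert (Huv' : Rabs u < Rabs v).
    { apply Rsqr_lt_abs_0. exact Huv. }
    (* The frequency of larger modulus reaches [cos PI = -1] here, while the other is still at an
       angle in [[0, PI)]. *)
    exists (PI / Rabs v).
    assert (Hc : forall z w, cos (z * w) = cos (Rabs z * w)).
    { intros z w. unfold Rabs. destruct (Rcase_abs z); auto.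
      rewrite <- cos_neg. f_equal. ring. }
    rewrite (Hc u), (Hc v). replace (Rabs v * (PI / Rabs v)) with PI by (field; lra).
    assert (Hpi := PI_RGT_0). intros Heq.
    assert (Hlt : Rabs u * (PI / Rabs v) < PI).
    { unfold Rdiv. rewrite <- (Rmult_1_r PI) at 2.
      replace (Rabs u * (PI * / Rabs v)) with (PI * (Rabs u / Rabs v)) by (unfold Rdiv; ring).
      apply Rmult_lt_compat_l; auto. apply Rlt_div_l; lra. }
    assert (Hge : 0 <= Rabs u * (PI / Rabs v)).
    { apply Rmult_le_pos; [apply Rabs_pos|]. apply Rlt_le, Rdiv_lt_0_compat; lra. }
    assert (cos PI < cos (Rabs u * (PI / Rabs v))) by (apply cos_decreasing_1; lra).
    lra. }
  assert (H2 : forall u v, u * u <> v * v -> exists s, cos (u * s) <> cos (v * s)).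
  { intros u v Huv. destruct (Rtotal_order (u * u) (v * v)) as [H|[H|H]]; [auto|lra|].
    destruct (H1 _ _ H) as [s Hs]. exists s. auto. }
  intros H.
  destruct (Req_dec (k * k) (k' * k')) as [Hk|Hk].
  2:{ destruct (H2 _ _ Hk) as [s Hs]. exists s, 0. now rewrite !Rmult_0_r, !Rplus_0_r. }
  destruct (Req_dec (l * l) (l' * l')) as [Hl|Hl].
  2:{ destruct (H2 _ _ Hl) as [s Hs]. exists 0, s. now rewrite !Rmult_0_r, !Rplus_0_l. }
  destruct H as [H|[H|H]]; [lra|lra|].
  assert (Hkk : k = k' \/ k = - k').
  { assert ((k - k') * (k + k') = 0) by nra.
    apply Rmult_integral in H0. destruct H0; [left|right]; lra. }
  assert (Hll : l = l' \/ l = - l').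
  { assert ((l - l') * (l + l') = 0) by nra.
    apply Rmult_integral in H0. destruct H0; [left|right]; lra. }
  assert (k <> 0) by (intros ->; destruct Hkk; subst; nra).
  assert (l <> 0) by (intros ->; destruct Hll; subst; nra).
  (* Each coordinate advances by a quarter turn: the angles add to [PI] for [(k, l)] and cancel for
     its mirror image. *)
  exists (PI / 2 / k), (PI / 2 / l).
  replace (k * (PI / 2 / k) + l * (PI / 2 / l)) with PI by (field; auto).
  assert (Hs : k' * (PI / 2 / k) + l' * (PI / 2 / l) = 0).
  { destruct Hkk as [->| ->], Hll as [->| ->]; try (exfalso; nra); field; split; lra. }
  rewrite Hs, cos_PI, cos_0. lra.
Qed.

Definition trig (k l A B x y : R) : R := A * cos (k * x + l * y) + B * sin (k * x + l * y).

(** Trigonometric waves are eigenfunctions of all symmetrised translations. *)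
Lemma trig_shift k l A B x y s t :
  trig k l A B (x + s) (y + t) + trig k l A B (x - s) (y - t)
  = 2 * cos (k * s + l * t) * trig k l A B x y.
Proof.
  unfold trig.
  replace (k * (x + s) + l * (y + t)) with ((k * x + l * y) + (k * s + l * t)) by ring.
  replace (k * (x - s) + l * (y - t)) with ((k * x + l * y) - (k * s + l * t)) by ring.
  generalize (k * x + l * y) (k * s + l * t). intros u v.
  rewrite cos_plus, sin_plus, cos_minus, sin_minus. ring.
Qed.

Lemma sum_single (f : nat -> R) (j m : nat) : (j <= m)%nat ->
  (forall i, (i <= m)%nat -> i <> j -> f i = 0) -> sum_f_R0 f m = f j.
Proof.
  intros Hj Hf. destruct m as [|m]; [replace j with 0%nat by lia; reflexivity|].
  rewrite (sum_skip _ j) by lia. rewrite (sum_eq _ (fun _ => 0)), sum_cte; [ring|].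
  intros i Hi. apply Hf; unfold skip; destruct (Nat.ltb_spec i j); lia.
Qed.

(* Elimination: [f (. + v) + f (. - v) - 2 cos (theta v) f] annihilates the frequency [theta]
   and multiplies every other frequency by a scalar. *)
Lemma trig_independent (k l A B : nat -> R) (m j0 : nat) : (j0 <= m)%nat ->
  k j0 <> 0 \/ l j0 <> 0 ->
  (forall j, (j <= m)%nat -> j <> j0 ->
     k j0 * k j0 <> k j * k j \/ l j0 * l j0 <> l j * l j \/ k j0 * l j0 <> k j * l j) ->
  (forall x y, sum_f_R0 (fun j => trig (k j) (l j) (A j) (B j) x y) m = 0) ->
  A j0 = 0 /\ B j0 = 0.
Proof.
  intros Hj0 Hnz Hsep Hsum.
  (* [d] counts the indices treated so far; [e] holds the scalars accumulated on the surviving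
     frequencies. *)
  assert (Helim : forall d, exists e : nat -> R, e j0 <> 0 /\
    (forall j, (j < d)%nat -> (j <= m)%nat -> j <> j0 -> e j = 0) /\
    forall x y, sum_f_R0 (fun j => e j * trig (k j) (l j) (A j) (B j) x y) m = 0).
  { induction d as [|d [e [He0 [Hez He]]]].
    - exists (fun _ => 1). split; [lra|]. split; [intros; lia|]. intros x y.
      transitivity (sum_f_R0 (fun j => trig (k j) (l j) (A j) (B j) x y) m);
        [apply sum_eq; intros; apply Rmult_1_l | apply Hsum].
    - destruct (Nat.eq_dec d j0) as [->|Hd].
      { exists e. split; auto. split; auto. intros j Hj Hjm Hjj. apply Hez; lia. }
      destruct (le_lt_dec d m) as [Hdm|Hdm].
      2:{ exists e. split; auto. split; auto. intros j Hj Hjm Hjj. apply Hez; lia. }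
      destruct (separating_shift _ _ _ _ (Hsep d Hdm Hd)) as [s [t Hst]].
      exists (fun j => 2 * (cos (k j * s + l j * t) - cos (k d * s + l d * t)) * e j).
      split; [|split].
      + intros H. apply Rmult_integral in H. destruct H; [lra|tauto].
      + intros j Hj Hjm Hjj. destruct (Nat.eq_dec j d) as [->|]; [ring|].
        rewrite Hez by lia. ring.
      + intros x y.
        rewrite (sum_eq _ (fun j => (e j * trig (k j) (l j) (A j) (B j) (x + s) (y + t)
           + e j * trig (k j) (l j) (A j) (B j) (x - s) (y - t))
           + e j * trig (k j) (l j) (A j) (B j) x y * (-2 * cos (k d * s + l d * t)))).
        * rewrite plus_sum, plus_sum, !He, <- scal_sum, He. ring.
        * intros j Hj. rewrite <- Rmult_plus_distr_l, trig_shift. ring. }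
  destruct (Helim (S m)) as [e [He0 [Hez He]]].
  assert (H : forall x y, trig (k j0) (l j0) (A j0) (B j0) x y = 0).
  { intros x y. specialize (He x y). rewrite (sum_single _ j0) in He; auto.
    - apply Rmult_integral in He. tauto.
    - intros i Hi Hij. rewrite Hez by (auto; lia). ring. }
  assert (HA : A j0 = 0).
  { specialize (H 0 0). unfold trig in H. rewrite !Rmult_0_r, Rplus_0_r, cos_0, sin_0 in H. lra. }
  split; auto. destruct Hnz as [Hn|Hn].
  - specialize (H (PI / 2 / k j0) 0). unfold trig in H.
    replace (k j0 * (PI / 2 / k j0) + l j0 * 0) with (PI / 2) in H by (field; auto).
    rewrite cos_PI2, sin_PI2 in H. lra.
  - specialize (H 0 (PI / 2 / l j0)). unfold trig in H.
    replace (k j0 * 0 + l j0 * (PI / 2 / l j0)) with (PI / 2) in H by (field; auto).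
    rewrite cos_PI2, sin_PI2 in H. lra.
Qed.

(** A linear relation between the coordinates is a trigonometric sum that vanishes identically, with
    frequencies distinct up to sign; positivity of the weights lets [sqrt (wt j)] be cancelled. *)
Lemma wave_full m kap lam wt :
  (forall j, (j <= m)%nat -> 0 < wt j) ->
  (forall j, (j <= m)%nat -> kap j <> 0 \/ lam j <> 0) ->
  (forall i j, (i <= m)%nat -> (j <= m)%nat -> i <> j ->
     kap i * kap i <> kap j * kap j \/ lam i * lam i <> lam j * lam j \/
     kap i * lam i <> kap j * lam j) ->
  full (2 * m + 1) (wave kap lam wt (fun _ => 1) 0).
Proof.
  intros Hw Hnz Hsep c Hc i Hi.
  assert (H : forall j, (j <= m)%nat -> c (2 * j)%nat = 0 /\ c (2 * j + 1)%nat = 0).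
  { intros j Hj.
    destruct (trig_independent kap lam (fun j => c (2 * j)%nat * sqrt (wt j))
                (fun j => c (2 * j + 1)%nat * sqrt (wt j)) m j) as [HA HB]; auto.
    - intros x y. rewrite <- (Hc x y). unfold dot. rewrite sum_pairs. apply sum_eq.
      intros j' Hj'. unfold wave, trig. destruct (double_div2 j') as [-> [-> [-> ->]]].
      set (th := kap j' * x + lam j' * y).
      replace (th - INR 0 * (PI / 2) + 0) with th by (simpl; ring).
      replace (th - INR 1 * (PI / 2) + 0) with (- (PI / 2 - th)) by (simpl; ring).
      rewrite cos_neg, cos_shift. ring.
    - assert (Hs := sqrt_lt_R0 _ (Hw j Hj)).
      apply Rmult_integral in HA. apply Rmult_integral in HB.
      split; [destruct HA | destruct HB]; auto; lra. }
  destruct (Nat.Even_or_Odd i) as [[j ->]|[j ->]]; apply H; lia.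
Qed.

(** The sums are moment conditions: total mass 1 places the image in the unit sphere, and second
    moments [a^2] times the identity make the map isometric. Up to a phase shift, every operator
    involved acts on the coordinates of frequency [j] by a scalar, so biharmonicity becomes an
    algebraic identity for these scalars. *)
Lemma wave_admits a m (k l : nat -> Z) (wt : nat -> R) (N1 N2 : nat) :
  0 < a -> (0 < N1)%nat -> (N1 < N2)%nat -> 4 * a ^ 2 = INR (N1 + N2) ->
  (forall j, (j <= m)%nat -> 0 < wt j) ->
  (forall j, (j <= m)%nat -> (k j * k j + l j * l j = Z.of_nat N1 \/
                              k j * k j + l j * l j = Z.of_nat N2)%Z) ->
  (forall i j, (i <= m)%nat -> (j <= m)%nat -> i <> j ->
     (k i * k i <> k j * k j \/ l i * l i <> l j * l j \/ k i * l i <> k j * l j)%Z) ->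
  sum_f_R0 wt m = 1 ->
  sum_f_R0 (fun j => IZR (k j * k j) * wt j) m = a ^ 2 ->
  sum_f_R0 (fun j => IZR (l j * l j) * wt j) m = a ^ 2 ->
  sum_f_R0 (fun j => IZR (k j * l j) * wt j) m = 0 ->
  admits_pbh_cmc a (2 * m + 1) ((INR N2 - INR N1) / INR (N1 + N2)).
Proof.
  intros Ha HN1 HN12 Ha2 Hw HN Hsep Sw Skk Sll Skl.
  set (kap := fun j => IZR (k j) / a). set (lam := fun j => IZR (l j) / a).
  set (W := wave kap lam wt).
  assert (Hw' : forall j, (j <= m)%nat -> 0 <= wt j) by (intros; apply Rlt_le; auto).
  assert (Hz : forall p q c, sum_f_R0 (fun j => IZR (p j * q j) * wt j) m = c ->
    sum_f_R0 (fun j => (1 * (IZR (p j) / a)) * (1 * (IZR (q j) / a)) * wt j) m = c / a ^ 2).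
  { intros p q c <-. unfold Rdiv. rewrite Rmult_comm, scal_sum. apply sum_eq.
    intros j Hj. rewrite mult_IZR. field. lra. }
  assert (Hkk := Hz k k _ Skk). assert (Hll := Hz l l _ Sll). assert (Hkl := Hz k l _ Skl).
  assert (Ha0 : a ^ 2 <> 0) by (apply pow_nonzero; lra).
  replace (a ^ 2 / a ^ 2) with 1 in Hkk, Hll by (field; lra).
  replace (0 / a ^ 2) with 0 in Hkl by (field; lra).
  set (h := (INR N2 - INR N1) / INR (N1 + N2)).
  assert (HNpos : 0 < INR (N1 + N2)) by (apply lt_0_INR; lia).
  assert (Hh : 0 < h).
  { apply Rdiv_lt_0_compat; auto. apply Rlt_0_minus. now apply lt_INR. }
  (* The factor by which the tension field multiplies frequency [j]: the Laplacian gives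
     [- (kap^2 + lam^2)] and the projection to the sphere adds 2. *)
  set (e := fun j => 2 - kap j * kap j - lam j * lam j).
  (* Since [a^2 = (N1 + N2) / 4], the factor is [2 h] on the circle [N1] and [- 2 h] on the circle
     [N2]. *)
  assert (He2 : forall j, (j <= m)%nat -> e j * e j = 4 * h * h).
  { intros j Hj. unfold e, h, kap, lam. rewrite plus_INR in *.
    assert (Hsum : a * a = (INR N1 + INR N2) / 4) by nra.
    assert (Hdiv : 2 - IZR (k j) / a * (IZR (k j) / a) - IZR (l j) / a * (IZR (l j) / a)
                   = 2 - IZR (k j * k j + l j * l j) / (a * a)).
    { rewrite plus_IZR, !mult_IZR. field. lra. }
    rewrite Hdiv, Hsum.
    destruct (HN j Hj) as [-> | ->]; rewrite <- INR_IZR_INZ; field; lra. }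
  assert (Se : sum_f_R0 (fun j => e j * wt j) m = 0).
  { rewrite (sum_eq _ (fun j => (wt j * 2
        + (1 * (IZR (k j) / a)) * (1 * (IZR (k j) / a)) * wt j * (-1))
        + (1 * (IZR (l j) / a)) * (1 * (IZR (l j) / a)) * wt j * (-1)))
      by (intros; unfold e, kap, lam; ring).
    rewrite !plus_sum, <- !scal_sum, Hkk, Hll, Sw. ring. }
  assert (See : sum_f_R0 (fun j => e j * e j * wt j) m = 4 * h * h).
  { rewrite (sum_eq _ (fun j => wt j * (4 * h * h)))
      by (intros j Hj; rewrite He2 by auto; ring).
    rewrite <- scal_sum, Sw. ring. }
  set (F := W (fun _ => 1) 0).
  assert (Fx : dX F = W (fun j => 1 * kap j) (0 + PI / 2)) by apply dX_wave.
  assert (Fy : dY F = W (fun j => 1 * lam j) (0 + PI / 2)) by apply dY_wave.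
  assert (Flap : forall x y i, lap F x y i = W (fun j => e j - 2) 0 x y i).
  { intros x y i. unfold lap. rewrite Fx, Fy. unfold W. rewrite dX_wave, dY_wave, !wave_plus_PI.
    unfold e, wave. ring. }
  assert (Flap' : lap F = W (fun j => e j - 2) 0)
    by (extensionality x; extensionality y; extensionality i; apply Flap).
  assert (Hc0 : cos (0 - 0) = 1) by (rewrite Rminus_0_r; apply cos_0).
  assert (Hc1 : cos (0 - (0 + PI / 2)) = 0)
    by (replace (0 - (0 + PI / 2)) with (- (PI / 2)) by ring; rewrite cos_neg; apply cos_PI2).
  assert (Hc2 : cos (0 + PI / 2 - 0) = 0)
    by (replace (0 + PI / 2 - 0) with (PI / 2) by ring; apply cos_PI2).
  assert (Hc3 : cos (0 + PI / 2 - (0 + PI / 2)) = 1)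
    by (replace (0 + PI / 2 - (0 + PI / 2)) with 0 by ring; apply cos_0).
  assert (FlapF : forall x y, dot (2 * m + 1) (lap F x y) (F x y) = -2).
  { intros x y. rewrite Flap'. unfold F, W. rewrite dot_wave, Hc0 by auto.
    rewrite (sum_eq _ (fun j => e j * wt j + wt j * (-2))) by (intros; ring).
    rewrite plus_sum, <- scal_sum, Se, Sw. ring. }
  assert (Htau : tension (2 * m + 1) F = W e 0).
  { extensionality x. extensionality y. extensionality i. unfold tension, tproj.
    rewrite FlapF, Flap. unfold F, W, wave. ring. }
  assert (HcX : connX (2 * m + 1) F (W e 0) = W (fun j => e j * kap j) (0 + PI / 2)).
  { extensionality x. extensionality y. extensionality i. unfold connX, tproj, F, W.
    rewrite dX_wave, dot_wave, Hc2 by auto. ring. }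
  assert (HcY : connY (2 * m + 1) F (W e 0) = W (fun j => e j * lam j) (0 + PI / 2)).
  { extensionality x. extensionality y. extensionality i. unfold connY, tproj, F, W.
    rewrite dY_wave, dot_wave, Hc2 by auto. ring. }
  exists F. split; [|split].
  - split; [|split; [|split; [|split]]].
    + apply wave_smooth.
    + now apply wave_periodic with k l.
    + intros x y. unfold F, W. rewrite dot_wave, Hc0 by auto.
      rewrite (sum_eq _ wt) by (intros; ring). rewrite Sw. ring.
    + intros x y. rewrite Fx, Fy. unfold W. rewrite !dot_wave, Hc3 by auto.
      unfold kap, lam. rewrite Hkk, Hkl, Hll. repeat split; ring.
    + apply wave_full; auto; unfold kap, lam.
      * intros j Hj.
        destruct (Z.eq_dec (k j) 0) as [Hk0|Hk0]; [destruct (Z.eq_dec (l j) 0) as [Hl0|Hl0]|].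
        -- specialize (HN j Hj). rewrite Hk0, Hl0 in HN. lia.
        -- right. apply Rmult_integral_contrapositive_currified;
             [now apply not_0_IZR | apply Rinv_neq_0_compat; lra].
        -- left. apply Rmult_integral_contrapositive_currified;
             [now apply not_0_IZR | apply Rinv_neq_0_compat; lra].
      * assert (Hcl : forall u v u' v', IZR u / a * (IZR v / a) = IZR u' / a * (IZR v' / a) ->
                        (u * v = u' * v')%Z).
        { intros u v u' v' Huv. apply eq_IZR. rewrite !mult_IZR.
          apply (Rmult_eq_reg_r (/ a ^ 2)); [|now apply Rinv_neq_0_compat].
          transitivity (IZR u / a * (IZR v / a)); [field; lra|].
          rewrite Huv. field; lra. }
        intros i j Hi Hj Hij. destruct (Hsep i j Hi Hj Hij) as [H|[H|H]];
          [left | right; left | right; right]; intros Heq; apply H, Hcl, Heq.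
  - split.
    + intros x y i Hi. unfold bitension, curv_trace. rewrite Htau, HcX, HcY.
      unfold connX, connY, tproj. rewrite Fx, Fy. unfold F, W.
      rewrite dX_wave, dY_wave, !dot_wave, Hc1, Hc3 by auto.
      unfold kap, lam. rewrite Hkk, Hll. fold kap lam.
      rewrite !wave_plus_PI.
      replace (cos (0 + PI / 2 + PI / 2 - 0)) with (-1)
        by (replace (0 + PI / 2 + PI / 2 - 0) with PI by field; now rewrite cos_PI).
      (* Up to sign, the inner product of the Laplacian of [W e 0] with [F]: as
         [kap^2 + lam^2 = 2 - e], the summands add up to [(2 e - e^2) wt]. *)
      assert (Sb : sum_f_R0 (fun j => e j * (IZR (k j) / a) * (IZR (k j) / a) * 1 * wt j) m
        + sum_f_R0 (fun j => e j * (IZR (l j) / a) * (IZR (l j) / a) * 1 * wt j) m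
        = - (4 * h * h)).
      { rewrite <- plus_sum.
        rewrite (sum_eq _ (fun j => e j * wt j * 2 + e j * e j * wt j * (-1)))
          by (intros; unfold e, kap, lam; ring).
        rewrite plus_sum, <- !scal_sum, Se, See. ring. }
      revert Sb. generalize (sum_f_R0 (fun j => e j * (IZR (k j) / a) * (IZR (k j) / a) * 1 * wt j) m).
      intros S1. generalize (sum_f_R0 (fun j => e j * (IZR (l j) / a) * (IZR (l j) / a) * 1 * wt j) m).
      intros S2 Sb. replace S2 with (- (4 * h * h) - S1) by lra.
      (* What remains at each frequency is [e^2 - 4 h^2], which vanishes on both circles. *)
      rewrite <- (He2 (i / 2)%nat) by (assert (i < 2 * (m + 1))%nat as Hlt by lia;
        apply Nat.Div0.div_lt_upper_bound in Hlt; lia).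
      unfold wave, e, kap, lam. ring.
    + intros Hharm.
      assert (H0 : dot (2 * m + 1) (tension (2 * m + 1) F 0 0) (tension (2 * m + 1) F 0 0) = 0).
      { unfold dot. rewrite (sum_eq _ (fun _ => 0)), sum_cte; [ring|].
        intros i Hi. rewrite Hharm by auto. ring. }
      rewrite Htau in H0. unfold W in H0. rewrite dot_wave, Hc0, See in H0 by auto. nra.
  - intros x y. unfold mean_curv.
    assert (HH : forall i, mean_curv_vec (2 * m + 1) F x y i = W (fun j => / 2 * e j) 0 x y i).
    { intros i. unfold mean_curv_vec. rewrite FlapF, Flap', Fx, Fy. unfold F, W.
      rewrite !dot_wave, Hc1 by auto. unfold wave. field. }
    unfold dot. rewrite (sum_eq _ (fun i => W (fun j => / 2 * e j) 0 x y i *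
       W (fun j => / 2 * e j) 0 x y i)) by (intros; now rewrite HH).
    change (sqrt (dot (2 * m + 1) (W (fun j => / 2 * e j) 0 x y) (W (fun j => / 2 * e j) 0 x y)) = h).
    unfold W. rewrite dot_wave, Hc0 by auto.
    rewrite (sum_eq _ (fun j => e j * e j * wt j * (/ 4))) by (intros; field).
    rewrite <- scal_sum, See.
    replace (1 * (/ 4 * (4 * h * h))) with (h * h) by field.
    apply sqrt_square. lra.
Qed.

(** * Choice of frequencies and weights *)

Definition lsum {A : Type} (f : A -> R) (l : list A) : R := fold_right (fun v s => f v + s) 0 l.

Lemma lsum_app {A : Type} (f : A -> R) l l' : lsum f (l ++ l') = lsum f l + lsum f l'.
Proof. induction l as [|v l IH]; simpl; [ring | rewrite IH; ring]. Qed.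

Lemma lsum_nth {A : Type} (f : A -> R) (d : A) l m : length l = S m ->
  sum_f_R0 (fun j => f (nth j l d)) m = lsum f l.
Proof.
  revert l. induction m as [|m IH]; intros [|v l] Hl; try discriminate.
  - destruct l; [simpl; ring | discriminate].
  - rewrite decomp_sum by lia. simpl. rewrite IH by (simpl in Hl; lia). reflexivity.
Qed.

(* A set of representatives of the nonzero integer vectors modulo sign. *)
Definition halfplane (v : Z * Z) : Prop := (0 < snd v \/ snd v = 0 /\ 0 < fst v)%Z.

Lemma halfplane_separated (v w : Z * Z) : halfplane v -> halfplane w -> v <> w ->
  (fst v * fst v <> fst w * fst w \/ snd v * snd v <> snd w * snd w \/
   fst v * snd v <> fst w * snd w)%Z.
Proof.
  destruct v as [x y], w as [x' y']. unfold halfplane; simpl. intros Hv Hw Hne.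
  destruct (Z.eq_dec (x * x) (x' * x')) as [Hx|]; [|now left].
  destruct (Z.eq_dec (y * y) (y' * y')) as [Hy|]; [|now right; left].
  right; right. intros Hxy. apply Hne.
  assert (y = y') by nia. subst y'.
  assert (x = x' \/ x = - x')%Z by nia.
  assert (x = x') by nia. now subst.
Qed.

(** Weighted lists replace indexed families, so that blocks of frequencies can be joined by [++] and
    their moments added. *)
Lemma list_admits (a : R) (L : list ((Z * Z) * R)) (m N1 N2 : nat) :
  0 < a -> (0 < N1)%nat -> (N1 < N2)%nat -> 4 * a ^ 2 = INR (N1 + N2) ->
  length L = S m -> NoDup (map fst L) ->
  (forall v, In v (map fst L) -> halfplane v /\
     (fst v * fst v + snd v * snd v = Z.of_nat N1 \/
      fst v * fst v + snd v * snd v = Z.of_nat N2)%Z) ->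
  (forall v, In v L -> 0 < snd v) ->
  lsum snd L = 1 ->
  lsum (fun v => IZR (fst (fst v) * fst (fst v)) * snd v) L = a ^ 2 ->
  lsum (fun v => IZR (snd (fst v) * snd (fst v)) * snd v) L = a ^ 2 ->
  lsum (fun v => IZR (fst (fst v) * snd (fst v)) * snd v) L = 0 ->
  admits_pbh_cmc a (2 * m + 1) ((INR N2 - INR N1) / INR (N1 + N2)).
Proof.
  intros Ha HN1 HN12 Ha2 HL Hnd Hfr Hw S1 Skk Sll Skl.
  set (d := ((0%Z, 0%Z), 0)).
  assert (Hin : forall j, (j <= m)%nat -> In (nth j L d) L)
    by (intros; apply nth_In; lia).
  assert (Hinf : forall j, (j <= m)%nat -> In (fst (nth j L d)) (map fst L))
    by (intros; apply in_map; auto).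
  apply (wave_admits a m (fun j => fst (fst (nth j L d))) (fun j => snd (fst (nth j L d)))
           (fun j => snd (nth j L d))); auto.
  - intros j Hj. apply Hfr; auto.
  - intros i j Hi Hj Hij. apply halfplane_separated; try apply Hfr; auto.
    rewrite <- !(map_nth fst). intros Heq. apply Hij.
    apply (proj1 (NoDup_nth (map fst L) (fst d)) Hnd); auto; rewrite length_map; lia.
  - rewrite (lsum_nth snd); auto.
  - rewrite <- Skk. apply (lsum_nth (fun v => IZR (fst (fst v) * fst (fst v)) * snd v)); auto.
  - rewrite <- Sll. apply (lsum_nth (fun v => IZR (snd (fst v) * snd (fst v)) * snd v)); auto.
  - rewrite <- Skl. apply (lsum_nth (fun v => IZR (fst (fst v) * snd (fst v)) * snd v)); auto.
Qed.

(** Only half of each quarter-turn orbit is listed: the opposite vectors give the same cosine and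
    sine coordinates up to sign. Each [v] thus accounts for four coordinates. *)
Definition orbits (w : R) (S : list (Z * Z)) : list ((Z * Z) * R) :=
  map (fun v => (v, w)) S ++ map (fun v => (rot v, w)) S.

Lemma map_fst_orbits w S : map fst (orbits w S) = S ++ map rot S.
Proof.
  unfold orbits. rewrite map_app, !map_map. f_equal. apply map_id.
Qed.

Lemma length_orbits w S : length (orbits w S) = (2 * length S)%nat.
Proof. unfold orbits. rewrite length_app, !length_map. lia. Qed.

Lemma in_orbits_snd w S v : In v (orbits w S) -> snd v = w.
Proof.
  unfold orbits. rewrite in_app_iff, !in_map_iff.
  intros [[u [<- _]]|[u [<- _]]]; reflexivity.
Qed.

(** For [v = (x, y)] the squares add up to [x^2 + y^2 = N] in either coordinate and the mixed terms
    [x y] and [- y x] cancel: the second moments are isotropic whichever orbits are taken. *)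
Lemma lsum_orbits w S N : (forall v, In v S -> (fst v * fst v + snd v * snd v = N)%Z) ->
  lsum snd (orbits w S) = 2 * INR (length S) * w /\
  lsum (fun v => IZR (fst (fst v) * fst (fst v)) * snd v) (orbits w S)
    = IZR N * INR (length S) * w /\
  lsum (fun v => IZR (snd (fst v) * snd (fst v)) * snd v) (orbits w S)
    = IZR N * INR (length S) * w /\
  lsum (fun v => IZR (fst (fst v) * snd (fst v)) * snd v) (orbits w S) = 0.
Proof.
  unfold orbits. rewrite !lsum_app. induction S as [|[x y] S IH]; intros HS.
  - simpl. repeat split; ring.
  - destruct IH as [H1 [H2 [H3 H4]]]; [intros; apply HS; now right|].
    assert (HN := HS (x, y) (or_introl eq_refl)). simpl in HN.
    apply (f_equal IZR) in HN. rewrite plus_IZR, !mult_IZR in HN.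
    simpl length. rewrite S_INR. simpl map. simpl lsum. rewrite !mult_IZR, !opp_IZR.
    rewrite <- HN in *. repeat split; lra.
Qed.

(** [rot] sends the region [x > 0, y >= 0] to [x <= 0, y > 0]: the two are disjoint and both lie in
    the half-plane. *)
Lemma quad_orbits N S : NoDup S -> (forall v, In v S -> In v (quad N)) ->
  NoDup (S ++ map rot S) /\
  forall v, In v (S ++ map rot S) -> halfplane v /\
    (fst v * fst v + snd v * snd v = Z.of_nat N)%Z.
Proof.
  intros Hnd HS. split.
  - apply NoDup_app; auto.
    + apply Injective_map_NoDup; auto. intros [x y] [x' y']. unfold rot; simpl.
      intros H. injection H as H1 H2. f_equal; lia.
    + intros [x y] H H'. apply HS, in_quad in H. apply in_map_iff in H'.
      destruct H' as [[x' y'] [He H']]. apply HS, in_quad in H'.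
      injection He as He1 He2. lia.
  - intros [x y] H. apply in_app_iff in H. destruct H as [H|H].
    + apply HS, in_quad in H. unfold halfplane; simpl. lia.
    + apply in_map_iff in H. destruct H as [[x' y'] [He H]]. apply HS, in_quad in H.
      injection He as <- <-. unfold halfplane; simpl. lia.
Qed.

Lemma incl_firstn {A : Type} (l : list A) s v : In v (firstn s l) -> In v l.
Proof. intros H. rewrite <- (firstn_skipn s l). apply in_app_iff. now left. Qed.

Lemma NoDup_firstn {A : Type} (l : list A) s : NoDup l -> NoDup (firstn s l).
Proof.
  intros H. rewrite <- (firstn_skipn s l) in H. eapply NoDup_app_remove_r. exact H.
Qed.

(** Any [s1] and [s2] orbits on the two circles will do; they give [2 (s1 + s2)] frequencies, hence
    [4 (s1 + s2) = n + 1] coordinates. *)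
Lemma orbit_admits (a : R) (N1 N2 s1 s2 : nat) :
  0 < a -> (0 < N1)%nat -> (N1 < N2)%nat -> 4 * a ^ 2 = INR (N1 + N2) ->
  (1 <= s1 <= length (quad N1))%nat -> (1 <= s2 <= length (quad N2))%nat ->
  admits_pbh_cmc a (4 * (s1 + s2) - 1) ((INR N2 - INR N1) / INR (N1 + N2)).
Proof.
  intros Ha HN1 HN12 Ha2 Hs1 Hs2.
  set (S1 := firstn s1 (quad N1)). set (S2 := firstn s2 (quad N2)).
  (* The [2 s1] frequencies of the first circle share the mass 1/2 equally, and so do the [2 s2] of
     the second. *)
  set (w1 := / (4 * INR s1)). set (w2 := / (4 * INR s2)).
  assert (Hp1 : 0 < INR s1) by (apply lt_0_INR; lia).
  assert (Hp2 : 0 < INR s2) by (apply lt_0_INR; lia).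
  assert (HS1 : length S1 = s1) by (apply firstn_length_le; lia).
  assert (HS2 : length S2 = s2) by (apply firstn_length_le; lia).
  assert (HQ1 : forall v, In v S1 -> In v (quad N1)) by (intros v; apply incl_firstn).
  assert (HQ2 : forall v, In v S2 -> In v (quad N2)) by (intros v; apply incl_firstn).
  assert (Hn : forall N S, (forall v, In v S -> In v (quad N)) ->
    forall v, In v S -> (fst v * fst v + snd v * snd v = Z.of_nat N)%Z).
  { intros N S HQ [x y] H. apply HQ, in_quad in H. simpl. lia. }
  destruct (lsum_orbits w1 S1 _ (Hn _ _ HQ1)) as [A1 [A2 [A3 A4]]].
  destruct (lsum_orbits w2 S2 _ (Hn _ _ HQ2)) as [B1 [B2 [B3 B4]]].
  destruct (quad_orbits N1 S1) as [C1 C2]; [apply NoDup_firstn, NoDup_quad | auto |].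
  destruct (quad_orbits N2 S2) as [D1 D2]; [apply NoDup_firstn, NoDup_quad | auto |].
  rewrite plus_INR in Ha2.
  replace (4 * (s1 + s2) - 1)%nat with (2 * (2 * (s1 + s2) - 1) + 1)%nat by lia.
  apply (list_admits a (orbits w1 S1 ++ orbits w2 S2)); auto.
  - now rewrite plus_INR.
  - rewrite length_app, !length_orbits. lia.
  - rewrite map_app, !map_fst_orbits. apply NoDup_app; auto.
    intros v H1 H2. apply C2 in H1. apply D2 in H2. lia.
  - intros v. rewrite map_app, !map_fst_orbits, in_app_iff.
    intros [H|H]; [apply C2 in H | apply D2 in H]; tauto.
  - intros v. rewrite in_app_iff.
    intros [H|H]; apply in_orbits_snd in H; rewrite H; apply Rinv_0_lt_compat; lra.
  - rewrite lsum_app, A1, B1, HS1, HS2. unfold w1, w2. field. lra.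
  - rewrite lsum_app, A2, B2, HS1, HS2, <- !INR_IZR_INZ. unfold w1, w2.
    replace (a ^ 2) with ((INR N1 + INR N2) / 4) by lra. field. lra.
  - rewrite lsum_app, A3, B3, HS1, HS2, <- !INR_IZR_INZ. unfold w1, w2.
    replace (a ^ 2) with ((INR N1 + INR N2) / 4) by lra. field. lra.
  - rewrite lsum_app, A4, B4. ring.
Qed.

Definition quad_off_axis (p : nat) : list (Z * Z) :=
  filter (fun v => negb (snd v =? 0)%Z) (quad (p * p)).

Lemma in_quad_off_axis (p : nat) v : In v (quad_off_axis p) ->
  In v (quad (p * p)) /\ (0 < snd v)%Z.
Proof.
  unfold quad_off_axis. rewrite filter_In, Bool.negb_true_iff, Z.eqb_neq.
  destruct v as [x y]. simpl. intros [H H0]. split; auto. apply in_quad in H. lia.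
Qed.

(** The axis vector [(p, 0)] is the only element of the quadrant missing from [quad_off_axis]. *)
Lemma r2_square_le (p : nat) : (0 < p)%nat ->
  (r2 (p * p) <= 4 * S (length (quad_off_axis p)))%nat.
Proof.
  intros Hp. apply (r2_le_quad _ ((Z.of_nat p, 0%Z) :: quad_off_axis p)); [nia|].
  intros [x y] H. destruct (Z.eq_dec y 0) as [->|Hy].
  - left. apply in_quad in H. f_equal. nia.
  - right. unfold quad_off_axis. rewrite filter_In, Bool.negb_true_iff, Z.eqb_neq. auto.
Qed.

(* The single frequency [(p, 0)] makes the metric of the first block anisotropic; the excess
   weight [w0 p^2 / q^2] at [(0, q)] compensates it. *)
Lemma axis_orbit_admits (a : R) (p q s t : nat) :
  0 < a -> (0 < p)%nat -> (p < q)%nat -> 4 * a ^ 2 = INR (p * p + q * q) ->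
  (s <= length (quad_off_axis p))%nat -> (t <= length (quad_off_axis q))%nat ->
  admits_pbh_cmc a (4 * (s + t) + 5) ((INR (q * q) - INR (p * p)) / INR (p * p + q * q)).
Proof.
  intros Ha Hp Hpq Ha2 Hs Ht.
  set (S1 := firstn s (quad_off_axis p)). set (S2 := firstn t (quad_off_axis q)).
  assert (Pp : 0 < INR p) by (apply lt_0_INR; lia).
  assert (Pq : INR p < INR q) by (apply lt_INR; lia).
  assert (Ps := pos_INR s). assert (Pt := pos_INR t).
  (* The [2 s + 1] frequencies of the circle of radius [p] share the mass 1/2 equally. *)
  set (w0 := / (2 * (2 * INR s + 1))).
  set (r := INR p * INR p / (INR q * INR q)).
  (* The circle of radius [q] carries [2 t + 2] frequencies of weight [w2] and the excess [w0 r],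
     again of total mass 1/2. The excess is below 1/2 because [p < q]. *)
  set (w2 := (/ 2 - w0 * r) / (2 * (INR t + 1))).
  assert (Hw0 : 0 < w0 <= / 2).
  { split; [apply Rinv_0_lt_compat; lra|]. apply Rinv_le_contravar; lra. }
  assert (Hr : 0 < r < 1).
  { split; [apply Rdiv_lt_0_compat; nra|]. apply Rlt_div_l; nra. }
  assert (Hw2 : 0 < w2) by (apply Rdiv_lt_0_compat; nra).
  assert (HS1 : length S1 = s) by (apply firstn_length_le; lia).
  assert (HS2 : length S2 = t) by (apply firstn_length_le; lia).
  assert (HQ1 : forall v, In v S1 -> In v (quad (p * p)) /\ (0 < snd v)%Z)
    by (intros v Hv; apply in_quad_off_axis; eapply incl_firstn; eauto).
  assert (HQ2 : forall v, In v S2 -> In v (quad (q * q)) /\ (0 < snd v)%Z)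
    by (intros v Hv; apply in_quad_off_axis; eapply incl_firstn; eauto).
  assert (Hn : forall N S, (forall v, In v S -> In v (quad N) /\ (0 < snd v)%Z) ->
    forall v, In v S -> (fst v * fst v + snd v * snd v = Z.of_nat N)%Z).
  { intros N S HQ [x y] H. destruct (HQ _ H) as [H0 _]. apply in_quad in H0. simpl. lia. }
  destruct (lsum_orbits w0 S1 _ (Hn _ _ HQ1)) as [A1 [A2 [A3 A4]]].
  destruct (lsum_orbits w2 S2 _ (Hn _ _ HQ2)) as [B1 [B2 [B3 B4]]].
  destruct (quad_orbits (p * p) S1) as [C1 C2];
    [apply NoDup_firstn, NoDup_filter, NoDup_quad | intros; now apply HQ1 |].
  destruct (quad_orbits (q * q) S2) as [D1 D2];
    [apply NoDup_firstn, NoDup_filter, NoDup_quad | intros; now apply HQ2 |].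
  set (P := Z.of_nat p). set (Q := Z.of_nat q).
  assert (HP : IZR P = INR p) by (symmetry; apply INR_IZR_INZ).
  assert (HQ : IZR Q = INR q) by (symmetry; apply INR_IZR_INZ).
  set (L2 := ((Q, 0%Z), w2) :: ((0%Z, Q), w2 + w0 * r) :: orbits w2 S2).
  set (L1 := ((P, 0%Z), w0) :: orbits w0 S1).
  assert (E1 : map fst L1 = (P, 0%Z) :: (S1 ++ map rot S1)).
  { unfold L1. simpl. now rewrite map_fst_orbits. }
  assert (E2 : map fst L2 = (Q, 0%Z) :: (0%Z, Q) :: (S2 ++ map rot S2)).
  { unfold L2. simpl. now rewrite map_fst_orbits. }
  assert (H1 : forall v, In v (map fst L1) -> halfplane v /\
    (fst v * fst v + snd v * snd v = Z.of_nat (p * p))%Z).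
  { intros v. rewrite E1. intros [<-|H]; [|now apply C2].
    unfold halfplane; simpl. unfold P. lia. }
  assert (H2 : forall v, In v (map fst L2) -> halfplane v /\
    (fst v * fst v + snd v * snd v = Z.of_nat (q * q))%Z).
  { intros v. rewrite E2. intros [<-|[<-|H]]; [| |now apply D2];
    unfold halfplane; simpl; unfold Q; lia. }
  (* Orbits off the axes cannot meet the axis vectors [(P, 0)], [(Q, 0)], [(0, Q)] added by hand. *)
  assert (Hoff : forall N S u v, (forall v, In v S -> In v (quad N) /\ (0 < snd v)%Z) ->
    In (u, v) (S ++ map rot S) -> (u <> 0 /\ v <> 0)%Z).
  { intros N S u v HS H. apply in_app_iff in H. destruct H as [H|H].
    - destruct (HS _ H) as [H0 H3]. apply in_quad in H0. simpl in H3. lia.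
    - apply in_map_iff in H. destruct H as [[x y] [He H]].
      destruct (HS _ H) as [H0 H3]. apply in_quad in H0. simpl in H3.
      injection He as <- <-. lia. }
  rewrite plus_INR, !mult_INR in Ha2.
  replace (4 * (s + t) + 5)%nat with (2 * (2 * (s + t) + 2) + 1)%nat by lia.
  apply (list_admits a (L1 ++ L2)); auto; try nia.
  - now rewrite plus_INR, !mult_INR.
  - rewrite length_app. unfold L1, L2. simpl length. rewrite !length_orbits. lia.
  - rewrite map_app. apply NoDup_app.
    + rewrite E1. constructor; auto. intros H. apply (Hoff _ _ _ _ HQ1) in H. lia.
    + rewrite E2. constructor.
      * intros [H|H]; [injection H; unfold Q; lia|].
        apply (Hoff _ _ _ _ HQ2) in H. lia.
      * constructor; auto. intros H. apply (Hoff _ _ _ _ HQ2) in H. lia.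
    + intros v Hv1 Hv2. apply H1 in Hv1. apply H2 in Hv2. nia.
  - intros v. rewrite map_app, in_app_iff.
    intros [H|H]; [apply H1 in H | apply H2 in H]; tauto.
  - intros v. rewrite in_app_iff. unfold L1, L2.
    intros [[<-|H]|[<-|[<-|H]]]; simpl; try (apply in_orbits_snd in H; rewrite H); nra.
  - rewrite lsum_app. unfold L1, L2. simpl lsum. rewrite A1, B1, HS1, HS2.
    replace (w0 + 2 * INR s * w0) with (/ 2) by (unfold w0; field; lra).
    unfold w2. field. lra.
  - rewrite lsum_app. unfold L1, L2. simpl lsum.
    rewrite A2, B2, HS1, HS2, <- !INR_IZR_INZ, !mult_IZR, HP, HQ, !mult_INR.
    unfold w2, r, w0. replace (a ^ 2) with ((INR p * INR p + INR q * INR q) / 4) by lra.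
    field. lra.
  - rewrite lsum_app. unfold L1, L2. simpl lsum.
    rewrite A3, B3, HS1, HS2, <- !INR_IZR_INZ, !mult_IZR, HQ, !mult_INR.
    unfold w2, r, w0. replace (a ^ 2) with ((INR p * INR p + INR q * INR q) / 4) by lra.
    field. lra.
  - rewrite lsum_app. unfold L1, L2. simpl lsum.
    rewrite A4, B4, !mult_IZR. ring.
Qed.

(** Here [(n + 1) / 4] orbits are distributed over the two circles with at least one on each;
    [n >= 7] makes their number at least two. *)
Lemma admits_of_two_circles (a : R) (N1 N2 n : nat) :
  0 < a -> (0 < N1)%nat -> (N1 < N2)%nat -> 4 * a ^ 2 = INR (N1 + N2) ->
  quad N1 <> nil -> quad N2 <> nil ->
  (n mod 4 = 3)%nat -> (7 <= n)%nat -> (n <= r2 N1 + r2 N2 - 1)%nat ->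
  admits_pbh_cmc a n ((INR N2 - INR N1) / INR (N1 + N2)).
Proof.
  intros Ha HN1 HN12 Ha2 HQ1 HQ2 Hn Hn7 Hr.
  assert (R1 := r2_le_quad N1 (quad N1) HN1 (fun v H => H)).
  assert (R2 := r2_le_quad N2 (quad N2) ltac:(lia) (fun v H => H)).
  assert (L1 : (1 <= length (quad N1))%nat)
    by (destruct (quad N1); [contradiction | simpl; lia]).
  assert (L2 : (1 <= length (quad N2))%nat)
    by (destruct (quad N2); [contradiction | simpl; lia]).
  assert (Hdm := Nat.div_mod_eq n 4). set (u := (n / 4)%nat) in *.
  (* As many orbits as possible from the first circle, keeping one for the second. *)
  set (s1 := Nat.min u (length (quad N1))).
  replace n with (4 * (s1 + (u + 1 - s1)) - 1)%nat by (unfold s1; lia).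
  apply orbit_admits; auto; unfold s1; lia.
Qed.

Lemma quad_nonempty (p q : nat) : (0 < p * p + q * q)%nat -> quad (p * p + q * q) <> nil.
Proof.
  intros H Hnil.
  assert (Hin : forall v, ~ In v (quad (p * p + q * q))) by (rewrite Hnil; auto).
  destruct (Nat.eq_dec p 0) as [->|Hp].
  - apply (Hin (Z.of_nat q, 0%Z)), in_quad. nia.
  - apply (Hin (Z.of_nat p, Z.of_nat q)), in_quad. lia.
Qed.

(** Residue 3 modulo 4 is covered by whole orbits; residue 1 uses an unpaired axis frequency, which
    exists because the radii [p] and [q] are integers. *)
Lemma admits_of_squares (a : R) (p q n : nat) :
  0 < a -> (0 < p)%nat -> (p < q)%nat -> 4 * a ^ 2 = INR (p * p + q * q) ->
  Nat.odd n = true -> (5 <= n)%nat -> (n <= r2 (p * p) + r2 (q * q) - 1)%nat ->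
  admits_pbh_cmc a n ((INR (q * q) - INR (p * p)) / INR (p * p + q * q)).
Proof.
  intros Ha Hp Hpq Ha2 Hodd Hn Hr.
  assert (Hdm := Nat.div_mod_eq n 4). assert (Hlt := Nat.mod_upper_bound n 4 ltac:(lia)).
  apply Nat.odd_spec in Hodd. destruct Hodd as [j Hj].
  assert (Hcase : (n mod 4 = 1 \/ n mod 4 = 3)%nat) by lia.
  destruct Hcase as [H1|H3].
  - assert (R1 := r2_square_le p Hp). assert (R2 := r2_square_le q ltac:(lia)).
    set (u := (n / 4 - 1)%nat).
    set (s := Nat.min u (length (quad_off_axis p))).
    replace n with (4 * (s + (u - s)) + 5)%nat by lia.
    apply axis_orbit_admits; auto; lia.
  - apply admits_of_two_circles; auto; try nia.
    + generalize (quad_nonempty p 0). rewrite Nat.mul_0_r, Nat.add_0_r. intros H. apply H. nia.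
    + generalize (quad_nonempty q 0). rewrite Nat.mul_0_r, Nat.add_0_r. intros H. apply H. nia.
Qed.

(** * Flat biharmonic surfaces in spheres *)

Definition lin (c : R) (U : vfun) (d : R) (V : vfun) : vfun :=
  fun x y i => c * U x y i + d * V x y i.

Lemma iterD_app w w' F : iterD (w ++ w') F = iterD w (iterD w' F).
Proof. induction w as [|b w IH]; simpl; [reflexivity | now rewrite IH]. Qed.

Lemma smooth_iterD n F w : smooth_on n F -> smooth_on n (iterD w F).
Proof. intros H w'. rewrite <- iterD_app. apply H. Qed.

Lemma smooth_dX n F : smooth_on n F -> smooth_on n (dX F).
Proof. apply (smooth_iterD n F (true :: nil)). Qed.

Lemma smooth_dY n F : smooth_on n F -> smooth_on n (dY F).
Proof. apply (smooth_iterD n F (false :: nil)). Qed.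

Lemma is_derive_dX n F i x y : smooth_on n F -> (i <= n)%nat ->
  is_derive (fun t => F t y i) x (dX F x y i).
Proof. intros H Hi. apply Derive_correct. now apply (H nil i Hi x y). Qed.

Lemma is_derive_dY n F i x y : smooth_on n F -> (i <= n)%nat ->
  is_derive (fun t => F x t i) y (dY F x y i).
Proof. intros H Hi. apply Derive_correct. now apply (H nil i Hi x y). Qed.

Lemma is_derive_lin (f g : R -> R) c d x f' g' : is_derive f x f' -> is_derive g x g' ->
  is_derive (fun t => c * f t + d * g t) x (c * f' + d * g').
Proof.
  intros Hf Hg. apply (is_derive_plus (K := R_AbsRing) (V := R_NormedModule));
    now apply is_derive_scal.
Qed.

Lemma dX_lin n U V c d i x y : smooth_on n U -> smooth_on n V -> (i <= n)%nat ->
  dX (lin c U d V) x y i = lin c (dX U) d (dX V) x y i.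
Proof.
  intros HU HV Hi. apply is_derive_unique, is_derive_lin; eapply is_derive_dX; eauto.
Qed.

Lemma dY_lin n U V c d i x y : smooth_on n U -> smooth_on n V -> (i <= n)%nat ->
  dY (lin c U d V) x y i = lin c (dY U) d (dY V) x y i.
Proof.
  intros HU HV Hi. apply is_derive_unique, is_derive_lin; eapply is_derive_dY; eauto.
Qed.

(** Coordinates above [n] are unconstrained, so identities between maps are carried as equalities
    for [i <= n] and not as equalities of functions. *)
Lemma dX_ext n U V : (forall i, (i <= n)%nat -> forall x y, U x y i = V x y i) ->
  forall i, (i <= n)%nat -> forall x y, dX U x y i = dX V x y i.
Proof. intros H i Hi x y. apply Derive_ext. intros t. now apply H. Qed.

Lemma dY_ext n U V : (forall i, (i <= n)%nat -> forall x y, U x y i = V x y i) ->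
  forall i, (i <= n)%nat -> forall x y, dY U x y i = dY V x y i.
Proof. intros H i Hi x y. apply Derive_ext. intros t. now apply H. Qed.

Lemma iterD_lin n U V c d w : smooth_on n U -> smooth_on n V ->
  forall i, (i <= n)%nat -> forall x y,
  iterD w (lin c U d V) x y i = lin c (iterD w U) d (iterD w V) x y i.
Proof.
  intros HU HV. induction w as [|b w IH]; intros i Hi x y; [reflexivity|].
  simpl. destruct b.
  - rewrite (dX_ext n _ _ IH i Hi). apply (dX_lin n); auto; now apply smooth_iterD.
  - rewrite (dY_ext n _ _ IH i Hi). apply (dY_lin n); auto; now apply smooth_iterD.
Qed.

Lemma smooth_lin n U V c d : smooth_on n U -> smooth_on n V -> smooth_on n (lin c U d V).
Proof.
  intros HU HV w i Hi x y.
  destruct (HU w i Hi x y) as [U1 [U2 U3]]. destruct (HV w i Hi x y) as [V1 [V2 V3]].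
  assert (E := iterD_lin n U V c d w HU HV i Hi).
  split; [|split].
  - apply (ex_derive_ext (fun t => lin c (iterD w U) d (iterD w V) t y i));
      [intros; now rewrite E|].
    unfold lin. apply Derive_correct in U1. apply Derive_correct in V1.
    eexists. apply is_derive_lin; eauto.
  - apply (ex_derive_ext (fun t => lin c (iterD w U) d (iterD w V) x t i));
      [intros; now rewrite E|].
    unfold lin. apply Derive_correct in U2. apply Derive_correct in V2.
    eexists. apply is_derive_lin; eauto.
  - apply (continuous_ext (fun p => lin c (iterD w U) d (iterD w V) (fst p) (snd p) i));
      [intros; now rewrite E|].
    unfold lin. apply (continuous_plus (V := R_NormedModule));
      apply (continuous_mult (K := R_AbsRing)); auto; apply continuous_const.
Qed.

Lemma lap_as_lin F : lap F = lin 1 (dX (dX F)) 1 (dY (dY F)).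
Proof.
  extensionality x. extensionality y. extensionality i. unfold lap, lin. ring.
Qed.

Lemma smooth_lap n F : smooth_on n F -> smooth_on n (lap F).
Proof.
  intros H. rewrite lap_as_lin. apply smooth_lin.
  - now apply smooth_dX, smooth_dX.
  - now apply smooth_dY, smooth_dY.
Qed.

Lemma lap_lin n U V c d i x y : smooth_on n U -> smooth_on n V -> (i <= n)%nat ->
  lap (lin c U d V) x y i = c * lap U x y i + d * lap V x y i.
Proof.
  intros HU HV Hi. unfold lap.
  assert (EX : forall i, (i <= n)%nat -> forall x y, dX (lin c U d V) x y i
    = lin c (dX U) d (dX V) x y i) by (intros; now apply (dX_lin n)).
  assert (EY : forall i, (i <= n)%nat -> forall x y, dY (lin c U d V) x y i
    = lin c (dY U) d (dY V) x y i) by (intros; now apply (dY_lin n)).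
  rewrite (dX_ext n _ _ EX i Hi), (dY_ext n _ _ EY i Hi).
  rewrite (dX_lin n), (dY_lin n); auto using smooth_dX, smooth_dY. unfold lin. ring.
Qed.

Lemma continuity_2d_of_continuous (f : R -> R -> R) x y :
  continuous (fun p : R * R => f (fst p) (snd p)) (x, y) -> continuity_2d_pt f x y.
Proof.
  intros H. apply continuity_2d_pt_filterlim. intros P HP.
  exact (H P HP).
Qed.

Lemma dXdY_comm n F : smooth_on n F -> forall i, (i <= n)%nat -> forall x y,
  dY (dX F) x y i = dX (dY F) x y i.
Proof.
  intros H i Hi x y. unfold dX, dY.
  symmetry. apply (Schwarz (fun u v => F u v i)).
  - apply locally_2d_forall. intros u v. repeat split.
    + apply (H nil i Hi u v).
    + apply (H nil i Hi u v).
    + apply (H (false :: nil) i Hi u v).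
    + apply (H (true :: nil) i Hi u v).
  - apply continuity_2d_of_continuous. apply (H (true :: false :: nil) i Hi x y).
  - apply continuity_2d_of_continuous. apply (H (false :: true :: nil) i Hi x y).
Qed.

Lemma dot_sym n u v : dot n u v = dot n v u.
Proof. apply sum_eq. intros; ring. Qed.

Lemma dot_ext n u u' v v' : (forall i, (i <= n)%nat -> u i = u' i) ->
  (forall i, (i <= n)%nat -> v i = v' i) -> dot n u v = dot n u' v'.
Proof. intros Hu Hv. apply sum_eq. intros i Hi. now rewrite Hu, Hv. Qed.

Lemma dot_lin_l n c u d v w :
  dot n (fun i => c * u i + d * v i) w = c * dot n u w + d * dot n v w.
Proof.
  unfold dot. rewrite !scal_sum, <- plus_sum. apply sum_eq. intros; ring.
Qed.

Lemma is_derive_dot n (u v : R -> nat -> R) (u' v' : nat -> R) t :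
  (forall i, (i <= n)%nat -> is_derive (fun s => u s i) t (u' i)) ->
  (forall i, (i <= n)%nat -> is_derive (fun s => v s i) t (v' i)) ->
  is_derive (fun s => dot n (u s) (v s)) t (dot n u' (v t) + dot n (u t) v').
Proof.
  unfold dot. rewrite <- plus_sum. induction n as [|n IH]; intros Hu Hv.
  - apply (is_derive_mult (fun s => u s 0%nat) (fun s => v s 0%nat)); auto. apply Rmult_comm.
  - simpl. apply (is_derive_plus (K := R_AbsRing) (V := R_NormedModule)).
    + apply IH; intros; auto.
    + apply (is_derive_mult (fun s => u s (S n)) (fun s => v s (S n))); auto. apply Rmult_comm.
Qed.

Lemma dot_const_dX n U V c : smooth_on n U -> smooth_on n V ->
  (forall x y, dot n (U x y) (V x y) = c) ->
  forall x y, dot n (dX U x y) (V x y) + dot n (U x y) (dX V x y) = 0.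
Proof.
  intros HU HV H x y.
  assert (D : is_derive (fun t => dot n (U t y) (V t y)) x
    (dot n (dX U x y) (V x y) + dot n (U x y) (dX V x y))).
  { apply (is_derive_dot n (fun t => U t y) (fun t => V t y)); intros i Hi;
      eapply is_derive_dX; eauto. }
  apply is_derive_unique in D. rewrite <- D.
  rewrite (Derive_ext _ (fun _ => c)) by (intros; apply H). apply Derive_const.
Qed.

Lemma dot_const_dY n U V c : smooth_on n U -> smooth_on n V ->
  (forall x y, dot n (U x y) (V x y) = c) ->
  forall x y, dot n (dY U x y) (V x y) + dot n (U x y) (dY V x y) = 0.
Proof.
  intros HU HV H x y.
  assert (D : is_derive (fun t => dot n (U x t) (V x t)) y
    (dot n (dY U x y) (V x y) + dot n (U x y) (dY V x y))).
  { apply (is_derive_dot n (fun t => U x t) (fun t => V x t)); intros i Hi;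
      eapply is_derive_dY; eauto. }
  apply is_derive_unique in D. rewrite <- D.
  rewrite (Derive_ext _ (fun _ => c)) by (intros; apply H). apply Derive_const.
Qed.

Lemma dot_lap_l n F u x y : dot n (lap F x y) u = dot n (dX (dX F) x y) u + dot n (dY (dY F) x y) u.
Proof.
  unfold dot. rewrite <- plus_sum. apply sum_eq. intros. unfold lap. ring.
Qed.

(** All follow by differentiating the constant products of [F], [F_x], [F_y]. The last six zeros say
    that the Christoffel symbols vanish: second derivatives have no tangential component. *)
Lemma isometric_identities n F : smooth_on n F -> into_unit_sphere n F -> isometric n F ->
  forall x y,
  (dot n (dX F x y) (F x y) = 0 /\ dot n (dY F x y) (F x y) = 0) /\
  (dot n (dX (dX F) x y) (F x y) = -1 /\ dot n (dY (dY F) x y) (F x y) = -1 /\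
   dot n (dY (dX F) x y) (F x y) = 0) /\
  (dot n (dX (dX F) x y) (dX F x y) = 0 /\ dot n (dX (dX F) x y) (dY F x y) = 0) /\
  (dot n (dY (dX F) x y) (dX F x y) = 0 /\ dot n (dY (dX F) x y) (dY F x y) = 0) /\
  (dot n (dY (dY F) x y) (dX F x y) = 0 /\ dot n (dY (dY F) x y) (dY F x y) = 0).
Proof.
  intros Hs Hsph Hiso x y.
  assert (HX := smooth_dX n F Hs). assert (HY := smooth_dY n F Hs).
  assert (Ixx : forall x y, dot n (dX F x y) (dX F x y) = 1) by (intros; apply Hiso).
  assert (Ixy : forall x y, dot n (dX F x y) (dY F x y) = 0) by (intros; apply Hiso).
  assert (Iyy : forall x y, dot n (dY F x y) (dY F x y) = 1) by (intros; apply Hiso).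
  assert (FX : forall x y, dot n (dX F x y) (F x y) = 0).
  { intros u v. assert (H := dot_const_dX n F F 1 Hs Hs Hsph u v).
    rewrite (dot_sym n (F u v)) in H. lra. }
  assert (FY : forall x y, dot n (dY F x y) (F x y) = 0).
  { intros u v. assert (H := dot_const_dY n F F 1 Hs Hs Hsph u v).
    rewrite (dot_sym n (F u v)) in H. lra. }
  assert (E1 := dot_const_dX n (dX F) F 0 HX Hs FX x y).
  assert (E2 := dot_const_dY n (dY F) F 0 HY Hs FY x y).
  assert (E3 := dot_const_dY n (dX F) F 0 HX Hs FX x y).
  assert (E4 := dot_const_dX n (dX F) (dX F) 1 HX HX Ixx x y).
  assert (E5 := dot_const_dY n (dX F) (dX F) 1 HX HX Ixx x y).
  assert (E6 := dot_const_dX n (dY F) (dY F) 1 HY HY Iyy x y).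
  assert (E7 := dot_const_dY n (dY F) (dY F) 1 HY HY Iyy x y).
  assert (E8 := dot_const_dX n (dX F) (dY F) 0 HX HY Ixy x y).
  assert (E9 := dot_const_dY n (dX F) (dY F) 0 HX HY Ixy x y).
  assert (HC : forall u, dot n (dX (dY F) x y) u = dot n (dY (dX F) x y) u).
  { intros u. apply dot_ext; auto. intros i Hi. symmetry. now apply (dXdY_comm n). }
  assert (HC' : forall u, dot n u (dX (dY F) x y) = dot n u (dY (dX F) x y)).
  { intros u. rewrite dot_sym, HC. apply dot_sym. }
  rewrite ?HC, ?HC' in *.
  rewrite Ixx in E1. rewrite Iyy in E2. rewrite Ixy in E3.
  rewrite (dot_sym n (dX F x y)) in E4, E5, E8, E9.
  rewrite (dot_sym n (dY F x y)) in E6, E7.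
  repeat split; auto; lra.
Qed.

(** Unlike [tension], this is linear in [F] with constant coefficients, so smoothness, periodicity
    and the Laplacian pass through it. *)
Definition tens (F : vfun) : vfun := lin 1 (lap F) 2 F.

Lemma smooth_tens n F : smooth_on n F -> smooth_on n (tens F).
Proof. intros H. apply smooth_lin; auto. now apply smooth_lap. Qed.

Lemma tens_normal n F : smooth_on n F -> into_unit_sphere n F -> isometric n F ->
  forall x y, dot n (lap F x y) (F x y) = -2 /\
  dot n (tens F x y) (F x y) = 0 /\ dot n (tens F x y) (dX F x y) = 0 /\
  dot n (tens F x y) (dY F x y) = 0.
Proof.
  intros Hs Hsph Hiso x y.
  destruct (isometric_identities n F Hs Hsph Hiso x y)
    as [[I1 I2] [[I3 [I4 I5]] [[I6 I7] [[I8 I9] [I10 I11]]]]].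
  assert (Hl : dot n (lap F x y) (F x y) = -2) by (rewrite dot_lap_l; lra).
  split; auto. unfold tens, lin. rewrite !dot_lin_l, !dot_lap_l, I3, I4.
  rewrite Hsph, I6, I7, I10, I11, (dot_sym n (F x y)), (dot_sym n (F x y) (dY F x y)), I1, I2.
  lra.
Qed.

Lemma tension_tens n F : smooth_on n F -> into_unit_sphere n F -> isometric n F ->
  forall i, (i <= n)%nat -> forall x y, tension n F x y i = tens F x y i.
Proof.
  intros Hs Hsph Hiso i Hi x y. unfold tension, tproj.
  destruct (tens_normal n F Hs Hsph Hiso x y) as [-> _]. unfold tens, lin. ring.
Qed.

Lemma tens_norm n F h : smooth_on n F -> into_unit_sphere n F -> isometric n F ->
  (forall x y, mean_curv n F x y = h) ->
  forall x y, dot n (tens F x y) (tens F x y) = 4 * h * h.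
Proof.
  intros Hs Hsph Hiso Hh x y.
  destruct (tens_normal n F Hs Hsph Hiso x y) as [Hl [_ [HX HY]]].
  destruct (isometric_identities n F Hs Hsph Hiso x y) as [[I1 I2] _].
  assert (Hlx : dot n (lap F x y) (dX F x y) = 0).
  { unfold tens, lin in HX. rewrite dot_lin_l, (dot_sym n (F x y)) in HX. lra. }
  assert (Hly : dot n (lap F x y) (dY F x y) = 0).
  { unfold tens, lin in HY. rewrite dot_lin_l, (dot_sym n (F x y)) in HY. lra. }
  specialize (Hh x y). unfold mean_curv in Hh.
  assert (HH : forall i, (i <= n)%nat -> mean_curv_vec n F x y i = / 2 * tens F x y i).
  { intros i Hi. unfold mean_curv_vec. rewrite Hl, Hlx, Hly. unfold tens, lin. ring. }
  rewrite (dot_ext n _ (fun i => / 2 * tens F x y i + 0 * tens F x y i)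
                     _ (fun i => / 2 * tens F x y i + 0 * tens F x y i)) in Hh
    by (intros; rewrite HH by auto; ring).
  rewrite dot_lin_l, dot_sym, dot_lin_l in Hh.
  assert (Hpos : 0 <= dot n (tens F x y) (tens F x y)).
  { apply cond_pos_sum. intros. apply Rle_0_sqr. }
  revert Hh Hpos. generalize (dot n (tens F x y) (tens F x y)). intros d Hh Hpos.
  replace (/ 2 * (/ 2 * d + 0 * d) + 0 * (/ 2 * d + 0 * d)) with (d / 4) in Hh by field.
  assert (Hsq := sqrt_sqrt (d / 4) ltac:(lra)). rewrite Hh in Hsq. lra.
Qed.

(** Differentiating [T.F = 0] gives [T_x.F = - T.F_x = 0], so covariant and Euclidean first
    derivatives of [T] agree. A second differentiation gives [lap T . F = - T_x.F_x - T_y.F_y = T .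
    lap F], which is [T.T] as [T] is orthogonal to [F]. *)
Lemma tens_derivatives n F : smooth_on n F -> into_unit_sphere n F -> isometric n F ->
  forall x y, dot n (dX (tens F) x y) (F x y) = 0 /\ dot n (dY (tens F) x y) (F x y) = 0 /\
  dot n (lap (tens F) x y) (F x y) = dot n (tens F x y) (tens F x y).
Proof.
  intros Hs Hsph Hiso x y.
  assert (HX := smooth_dX n F Hs). assert (HY := smooth_dY n F Hs).
  assert (HT := smooth_tens n F Hs).
  assert (HTX := smooth_dX n _ HT). assert (HTY := smooth_dY n _ HT).
  assert (N := tens_normal n F Hs Hsph Hiso).
  assert (N0 : forall x y, dot n (tens F x y) (F x y) = 0) by (intros; apply N).
  assert (N1 : forall x y, dot n (tens F x y) (dX F x y) = 0) by (intros; apply N).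
  assert (N2 : forall x y, dot n (tens F x y) (dY F x y) = 0) by (intros; apply N).
  assert (P1 : forall x y, dot n (dX (tens F) x y) (F x y) = 0).
  { intros u v. assert (H := dot_const_dX n _ _ 0 HT Hs N0 u v). rewrite N1 in H. lra. }
  assert (P2 : forall x y, dot n (dY (tens F) x y) (F x y) = 0).
  { intros u v. assert (H := dot_const_dY n _ _ 0 HT Hs N0 u v). rewrite N2 in H. lra. }
  repeat split; auto.
  assert (E1 := dot_const_dX n _ _ 0 HTX Hs P1 x y).
  assert (E2 := dot_const_dY n _ _ 0 HTY Hs P2 x y).
  assert (E3 := dot_const_dX n _ _ 0 HT HX N1 x y).
  assert (E4 := dot_const_dY n _ _ 0 HT HY N2 x y).
  rewrite dot_lap_l.
  assert (E5 : dot n (tens F x y) (tens F x y) = dot n (tens F x y) (lap F x y)).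
  { unfold tens at 1, lin. rewrite dot_lin_l.
    rewrite (dot_sym n (F x y)), N0, (dot_sym n (lap F x y)). ring. }
  rewrite E5, (dot_sym n (tens F x y)), dot_lap_l.
  rewrite (dot_sym n (dX (dX F) x y)), (dot_sym n (dY (dY F) x y)). lra.
Qed.

(** Only the second covariant derivative differs from the Euclidean one, by
    [(lap T . F) F = 4 h^2 F], and the curvature trace is [- 2 T] because [T] is normal. *)
Lemma biharmonic_tens n F h : smooth_on n F -> into_unit_sphere n F -> isometric n F ->
  biharmonic n F -> (forall x y, mean_curv n F x y = h) ->
  forall i, (i <= n)%nat -> forall x y,
  lap (tens F) x y i = 4 * h * h * F x y i - 2 * tens F x y i.
Proof.
  intros Hs Hsph Hiso Hbi Hh i Hi x y.
  assert (HT := smooth_tens n F Hs).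
  assert (HTX := smooth_dX n _ HT). assert (HTY := smooth_dY n _ HT).
  assert (Ht := tension_tens n F Hs Hsph Hiso).
  assert (D := tens_derivatives n F Hs Hsph Hiso).
  assert (CX : forall i, (i <= n)%nat -> forall x y,
    connX n F (tension n F) x y i = dX (tens F) x y i).
  { intros j Hj u v. unfold connX, tproj. rewrite (dX_ext n _ _ Ht j Hj).
    rewrite (dot_ext n _ (dX (tens F) u v) _ (F u v)); auto.
    - destruct (D u v) as [-> _]. ring.
    - intros l Hl. now apply (dX_ext n). }
  assert (CY : forall i, (i <= n)%nat -> forall x y,
    connY n F (tension n F) x y i = dY (tens F) x y i).
  { intros j Hj u v. unfold connY, tproj. rewrite (dY_ext n _ _ Ht j Hj).
    rewrite (dot_ext n _ (dY (tens F) u v) _ (F u v)); auto.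
    - destruct (D u v) as [_ [-> _]]. ring.
    - intros l Hl. now apply (dY_ext n). }
  specialize (Hbi x y i Hi). unfold bitension, curv_trace in Hbi.
  unfold connX at 1, connY at 1, tproj in Hbi.
  rewrite (dX_ext n _ _ CX i Hi), (dY_ext n _ _ CY i Hi), (Ht i Hi) in Hbi.
  rewrite (dot_ext n (dX (connX n F (tension n F)) x y) (dX (dX (tens F)) x y)
             (F x y) (F x y)) in Hbi; auto.
  2:{ intros l Hl. now apply (dX_ext n). }
  rewrite (dot_ext n (dY (connY n F (tension n F)) x y) (dY (dY (tens F)) x y)
             (F x y) (F x y)) in Hbi; auto.
  2:{ intros l Hl. now apply (dY_ext n). }
  rewrite (dot_ext n (tension n F x y) (tens F x y) (dX F x y) (dX F x y)) in Hbi; auto.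
  rewrite (dot_ext n (tension n F x y) (tens F x y) (dY F x y) (dY F x y)) in Hbi; auto.
  destruct (tens_normal n F Hs Hsph Hiso x y) as [_ [_ [N1 N2]]].
  destruct (Hiso x y) as [I1 [_ I2]]. rewrite N1, N2, I1, I2 in Hbi.
  destruct (D x y) as [_ [_ D3]]. rewrite (tens_norm n F h), dot_lap_l in D3; auto.
  unfold lap. rewrite <- D3. lra.
Qed.

(* The two eigencomponents of [F], up to the factor [4 h]. *)
Lemma eigen_components n F h : smooth_on n F -> into_unit_sphere n F -> isometric n F ->
  biharmonic n F -> (forall x y, mean_curv n F x y = h) ->
  forall s, s * s = h * h ->
  let G := lin 1 (tens F) (2 * s) F in
  smooth_on n G /\
  (forall i, (i <= n)%nat -> forall x y, lap G x y i = - (2 * (1 - s)) * G x y i) /\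
  forall x y, dot n (G x y) (F x y) = 2 * s.
Proof.
  intros Hs Hsph Hiso Hbi Hh s Hsh G.
  assert (HT := smooth_tens n F Hs). split; [|split].
  - now apply smooth_lin.
  - intros i Hi x y. unfold G. rewrite (lap_lin n), (biharmonic_tens n F h); auto.
    replace (lap F x y i) with (tens F x y i - 2 * F x y i) by (unfold tens, lin; ring).
    unfold lin. replace (4 * h * h) with (4 * (s * s)) by lra. ring.
  - intros x y. unfold G, lin. rewrite dot_lin_l, Hsph.
    destruct (tens_normal n F Hs Hsph Hiso x y) as [_ [-> _]]. ring.
Qed.

(** * Orthogonal families and the exclusion of the 3-sphere *)

Lemma dot_self_eq_0 n u : dot n u u = 0 -> forall i, (i <= n)%nat -> u i = 0.
Proof.
  unfold dot. induction n as [|n IH]; intros H i Hi.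
  - replace i with 0%nat by lia. simpl in H. nra.
  - simpl in H.
    assert (0 <= sum_f_R0 (fun i => u i * u i) n) by (apply cond_pos_sum; intros; nra).
    destruct (Nat.eq_dec i (S n)) as [->|]; [nra|]. apply IH; [nra|lia].
Qed.

Lemma sum_swap (f : nat -> nat -> R) m n :
  sum_f_R0 (fun i => sum_f_R0 (fun j => f i j) n) m
  = sum_f_R0 (fun j => sum_f_R0 (fun i => f i j) m) n.
Proof.
  induction m as [|m IH]; [reflexivity|]. simpl. rewrite IH, <- plus_sum. reflexivity.
Qed.

(** [n + 2] vectors in dimension [n + 1] satisfy a relation with some [c k <> 0]; its product with
    [E k] leaves [c k |E k|^2 = 0]. *)
Lemma orthogonal_family_degenerate n (E : nat -> nat -> R) :
  (forall i j, (i <= S n)%nat -> (j < i)%nat -> dot n (E i) (E j) = 0) ->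
  exists k, (k <= S n)%nat /\ dot n (E k) (E k) = 0.
Proof.
  intros HE.
  destruct (exists_nontrivial_kernel (S n) (S n) (fun j i => E i j))
    as [c [[k [Hk Hck]] Hc]]; [lia|].
  exists k. split; auto.
  assert (H : sum_f_R0 (fun i => c i * dot n (E i) (E k)) (S n) = 0).
  { unfold dot. rewrite (sum_eq _ (fun i => sum_f_R0 (fun j => E i j * c i * E k j) n)).
    - rewrite sum_swap. rewrite (sum_eq _ (fun _ => 0)), sum_cte; [ring|].
      intros j Hj. rewrite <- scal_sum, Hc by lia. ring.
    - intros i Hi. rewrite scal_sum. apply sum_eq. intros; ring. }
  rewrite (sum_single _ k) in H; auto.
  - apply Rmult_integral in H. tauto.
  - intros i Hi Hik. destruct (lt_eq_lt_dec i k) as [[Hlt|]|Hlt]; [|contradiction|].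
    + rewrite dot_sym, HE by auto. ring.
    + rewrite HE by auto. ring.
Qed.

(** Of five orthogonal vectors in [R^4] one is null, and it can only be [u]. *)
Lemma orthonormal_frame_complete (e0 e1 e2 e3 u : nat -> R) :
  dot 3 e0 e0 = 1 -> dot 3 e1 e1 = 1 -> dot 3 e2 e2 = 1 -> dot 3 e3 e3 = 1 ->
  dot 3 e1 e0 = 0 -> dot 3 e2 e0 = 0 -> dot 3 e3 e0 = 0 ->
  dot 3 e2 e1 = 0 -> dot 3 e3 e1 = 0 -> dot 3 e3 e2 = 0 ->
  dot 3 u e0 = 0 -> dot 3 u e1 = 0 -> dot 3 u e2 = 0 -> dot 3 u e3 = 0 ->
  forall i, (i <= 3)%nat -> u i = 0.
Proof.
  intros N0 N1 N2 N3 O1 O2 O3 O4 O5 O6 U0 U1 U2 U3. apply dot_self_eq_0.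
  destruct (orthogonal_family_degenerate 3
    (fun i => match i with 0 => e0 | 1 => e1 | 2 => e2 | 3 => e3 | _ => u end)%nat)
    as [k [Hk Hkk]].
  - intros i j Hi Hj.
    do 5 (destruct i as [|i]; [do 5 (destruct j as [|j]; [auto; lia|]); lia|]). lia.
  - do 4 (destruct k as [|k]; [lra|]). auto.
Qed.

(* In [S^3] the Gauss equation of a flat surface, [det A = -1], together with
   [|A|^2 = 2] (from biharmonicity) gives [(trace A)^2 = 0]. *)
Lemma no_flat_cmc_biharmonic_S3 F h : smooth_on 3 F -> into_unit_sphere 3 F -> isometric 3 F ->
  biharmonic 3 F -> (forall x y, mean_curv 3 F x y = h) -> h = 0.
Proof.
  intros Hs Hsph Hiso Hbi Hh.
  destruct (Req_dec h 0) as [|Hh0]; auto. exfalso. apply Hh0.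
  assert (HX := smooth_dX 3 F Hs). assert (HY := smooth_dY 3 F Hs).
  assert (HT := smooth_tens 3 F Hs).
  assert (HTX := smooth_dX 3 _ HT). assert (HTY := smooth_dY 3 _ HT).
  assert (I := isometric_identities 3 F Hs Hsph Hiso).
  assert (TN := tens_norm 3 F h Hs Hsph Hiso Hh).
  assert (N := tens_normal 3 F Hs Hsph Hiso).
  assert (N1 : forall x y, dot 3 (tens F x y) (dX F x y) = 0) by (intros; apply N).
  assert (N2 : forall x y, dot 3 (tens F x y) (dY F x y) = 0) by (intros; apply N).
  assert (TX : forall x y, dot 3 (dX (tens F) x y) (tens F x y) = 0).
  { intros x y. assert (E := dot_const_dX 3 _ _ _ HT HT TN x y).
    rewrite (dot_sym 3 (tens F x y)) in E. lra. }
  assert (TY : forall x y, dot 3 (dY (tens F) x y) (tens F x y) = 0).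
  { intros x y. assert (E := dot_const_dY 3 _ _ _ HT HT TN x y).
    rewrite (dot_sym 3 (tens F x y)) in E. lra. }
  (* Gauss equation: the derivatives of [F_xx.F_y = 0] in [y] and of [F_xy.F_y = 0] in [x] share
     their third-order term, so [F_xx.F_yy = F_xy.F_xy]. *)
  assert (G1 := dot_const_dY 3 _ _ 0 (smooth_dX 3 _ HX) HY
    (fun x y => proj2 (proj1 (proj2 (proj2 (I x y))))) 0 0).
  assert (G2 := dot_const_dX 3 _ _ 0 (smooth_dY 3 _ HX) HY
    (fun x y => proj2 (proj1 (proj2 (proj2 (proj2 (I x y)))))) 0 0).
  (* As [T] has constant length, [lap T . T = - |T_x|^2 - |T_y|^2]. *)
  assert (X1 := dot_const_dX 3 _ _ 0 HTX HT TX 0 0).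
  assert (Y1 := dot_const_dY 3 _ _ 0 HTY HT TY 0 0).
  assert (S1 := dot_const_dX 3 _ _ 0 HT HX N1 0 0).
  assert (S2 := dot_const_dY 3 _ _ 0 HT HX N1 0 0).
  assert (S3 := dot_const_dX 3 _ _ 0 HT HY N2 0 0).
  assert (S4 := dot_const_dY 3 _ _ 0 HT HY N2 0 0).
  assert (HC : forall u, dot 3 u (dX (dY F) 0 0) = dot 3 u (dY (dX F) 0 0)).
  { intros u. apply dot_ext; auto. intros i Hi. symmetry. now apply (dXdY_comm 3). }
  assert (HC3 : forall u, dot 3 (dX (dY (dX F)) 0 0) u = dot 3 (dY (dX (dX F)) 0 0) u).
  { intros u. apply dot_ext; auto. intros i Hi. symmetry. now apply (dXdY_comm 3). }
  assert (LT : dot 3 (lap (tens F) 0 0) (tens F 0 0) = - 2 * (4 * h * h)).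
  { rewrite (dot_ext 3 _ (fun i => 4 * h * h * F 0 0 i + (-2) * tens F 0 0 i) _ (tens F 0 0)); auto.
    - rewrite dot_lin_l, (dot_sym 3 (F 0 0)), TN. destruct (N 0 0) as [_ [-> _]]. ring.
    - intros i Hi. rewrite (biharmonic_tens 3 F h); auto. ring. }
  rewrite dot_lap_l in LT.
  assert (TT : dot 3 (dX (dX F) 0 0) (tens F 0 0) + dot 3 (dY (dY F) 0 0) (tens F 0 0) = 4 * h * h).
  { rewrite <- dot_lap_l, <- (TN 0 0). symmetry. unfold tens at 1, lin. rewrite dot_lin_l.
    rewrite (dot_sym 3 (F 0 0)). destruct (N 0 0) as [_ [-> _]]. ring. }
  destruct (I 0 0) as [[I1 I2] [[I3 [I4 I5]] [[I6 I7] [[I8 I9] [I10 I11]]]]].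
  destruct (Hiso 0 0) as [J1 [J2 J3]].
  destruct (N 0 0) as [_ [M1 [M2 M3]]].
  destruct (tens_derivatives 3 F Hs Hsph Hiso 0 0) as [D1 [D2 _]].
  specialize (TN 0 0). specialize (TX 0 0). specialize (TY 0 0). specialize (Hsph 0 0).
  clear N1 N2 N I Hiso Hbi Hh HX HY HT HTX HTY Hs.
  rewrite HC in G2, S3. rewrite HC3 in G2.
  set (e0 := F 0 0) in *. set (e1 := dX F 0 0) in *. set (e2 := dY F 0 0) in *.
  set (t := tens F 0 0) in *. set (tx := dX (tens F) 0 0) in *. set (ty := dY (tens F) 0 0) in *.
  set (xx := dX (dX F) 0 0) in *. set (yy := dY (dY F) 0 0) in *. set (xy := dY (dX F) 0 0) in *.
  (* [al], [be], [ga] are the entries of the second fundamental form paired with [T], whose squared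
     length is [4 h^2]. *)
  set (al := dot 3 xx t) in *. set (ga := dot 3 yy t) in *. set (be := dot 3 xy t).
  rewrite (dot_sym 3 t) in S1, S2, S3, S4. fold al be ga in S1, S2, S3, S4.
  clearbody e0 e1 e2 t tx ty xx yy xy.
  assert (Hh2 : 0 < h * h) by nra.
  assert (I1' : dot 3 e0 e1 = 0) by now rewrite dot_sym.
  assert (I2' : dot 3 e0 e2 = 0) by now rewrite dot_sym.
  assert (J2' : dot 3 e2 e1 = 0) by now rewrite dot_sym.
  assert (M1' : dot 3 e0 t = 0) by now rewrite dot_sym.
  assert (M2' : dot 3 e1 t = 0) by now rewrite dot_sym.
  assert (M3' : dot 3 e2 t = 0) by now rewrite dot_sym.
  (* Parseval in the orthonormal frame [e0, e1, e2, t / (2 h)]. *)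
  assert (Pars : forall u v, dot 3 u v = dot 3 u e0 * dot 3 v e0 + dot 3 u e1 * dot 3 v e1
    + dot 3 u e2 * dot 3 v e2 + dot 3 u t * dot 3 v t / (4 * h * h)).
  { intros u v.
    set (a0 := dot 3 u e0). set (a1 := dot 3 u e1). set (a2 := dot 3 u e2). set (a3 := dot 3 u t).
    (* The residual of [u] against the frame; once it is zero, its product with [v] is Parseval's
       identity. *)
    set (r := fun i => 1 * (1 * (1 * (1 * u i + (- a0) * e0 i) + (- a1) * e1 i)
       + (- a2) * e2 i) + (- (a3 / (4 * h * h))) * t i).
    set (e3 := fun i => / (2 * h) * t i + 0 * t i).
    assert (R0 : dot 3 r e0 = 0).
    { unfold r. rewrite !dot_lin_l, Hsph, I1, I2, M1. fold a0. ring. }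
    assert (R1 : dot 3 r e1 = 0).
    { unfold r. rewrite !dot_lin_l, I1', J1, J2', M2. fold a1. ring. }
    assert (R2 : dot 3 r e2 = 0).
    { unfold r. rewrite !dot_lin_l, I2', J2, J3, M3. fold a2. ring. }
    assert (R3 : dot 3 r t = 0).
    { unfold r. rewrite !dot_lin_l, M1', M2', M3', TN. fold a3. field. auto. }
    assert (Hr : forall i, (i <= 3)%nat -> r i = 0).
    { apply (orthonormal_frame_complete e0 e1 e2 e3); auto; unfold e3;
        rewrite ?dot_lin_l, ?M1, ?M2, ?M3; try ring.
      - rewrite dot_sym, dot_lin_l, TN. field. auto.
      - rewrite dot_sym, dot_lin_l, dot_sym, R3. ring. }
    assert (Hv : dot 3 r v = 0).
    { rewrite (dot_ext 3 r (fun i => 0 * v i + 0 * v i) v v); auto.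
      - rewrite dot_lin_l. ring.
      - intros i Hi. rewrite Hr by auto. ring. }
    unfold r in Hv. rewrite !dot_lin_l in Hv.
    rewrite (dot_sym 3 e0), (dot_sym 3 e1), (dot_sym 3 e2), (dot_sym 3 t) in Hv.
    unfold Rdiv in *. lra. }
  assert (PX := Pars tx tx). assert (PY := Pars ty ty).
  assert (PG1 := Pars xx yy). assert (PG2 := Pars xy xy).
  rewrite D1, TX in PX. rewrite D2, TY in PY.
  rewrite I3, I4, I6, I7, I10, I11 in PG1. rewrite I5, I8, I9 in PG2.
  fold al ga in PG1. fold be in PG2.
  set (k := / (4 * h * h)) in *.
  assert (Hk : k * (4 * h * h) = 1) by (unfold k; field; auto).
  unfold Rdiv in *. fold k in PX, PY, PG1, PG2.
  replace (dot 3 tx e1) with (- al) in PX by lra.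
  replace (dot 3 tx e2) with (- be) in PX by lra.
  replace (dot 3 ty e1) with (- be) in PY by lra.
  replace (dot 3 ty e2) with (- ga) in PY by lra.
  (* [Q1] is [|T_x|^2 + |T_y|^2 = 8 h^2] expanded in the frame, [Q2] the Gauss equation. *)
  assert (Q1 : al * al + 2 * be * be + ga * ga = 2 * (4 * h * h)) by lra.
  assert (Q2 : 1 + al * ga * k = be * be * k) by lra.
  assert (Q3 : 4 * h * h + al * ga = be * be).
  { transitivity ((1 + al * ga * k) * (4 * h * h)); [|rewrite Q2].
    - transitivity (4 * h * h + al * ga * (k * (4 * h * h))); [rewrite Hk; ring | ring].
    - transitivity (be * be * (k * (4 * h * h))); [ring | rewrite Hk; ring]. }
  assert (Q4 : (al + ga) * (al + ga) = 0) by lra.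
  (* [al + ga] is [lap F . T = 4 h^2], so its vanishing forces [h = 0]. *)
  rewrite TT in Q4. nra.
Qed.

(** * Periodic ordinary differential equations and Fourier uniqueness *)

Lemma constant_of_zero_derive (f : R -> R) : (forall x, is_derive f x 0) -> forall x y, f x = f y.
Proof.
  intros H.
  assert (Hlt : forall x y, x < y -> f x = f y).
  { intros x y Hxy. now apply (eq_is_derive f x y). }
  intros x y. destruct (Rtotal_order x y) as [Hx|[->|Hx]]; auto. symmetry. auto.
Qed.

(** The energy [g'^2 + mu g^2] is conserved and vanishes at 0. *)
Lemma ode_unique (g g' : R -> R) mu : 0 < mu ->
  (forall x, is_derive g x (g' x)) -> (forall x, is_derive g' x (- mu * g x)) ->
  g 0 = 0 -> g' 0 = 0 -> forall x, g x = 0.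
Proof.
  intros Hmu Hg Hg' G0 G1 x.
  assert (D : forall t, is_derive (fun t => g' t * g' t + mu * (g t * g t)) t 0).
  { intros t.
    replace 0 with ((- mu * g t * g' t + g' t * (- mu * g t)) + mu * (g' t * g t + g t * g' t))
      by ring.
    apply (is_derive_plus (fun t => g' t * g' t)).
    - apply (is_derive_mult g' g'); auto. intros; apply Rmult_comm.
    - apply is_derive_scal, (is_derive_mult g g); auto. intros; apply Rmult_comm. }
  assert (HE := constant_of_zero_derive _ D x 0). simpl in HE. rewrite G0, G1 in HE.
  assert (Hsq : mu * (g x * g x) = 0).
  { assert (0 <= g x * g x) by apply Rle_0_sqr. assert (0 <= g' x * g' x) by apply Rle_0_sqr. nra. }
  apply Rmult_integral in Hsq. destruct Hsq as [|Hsq]; [lra|].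
  apply Rmult_integral in Hsq. tauto.
Qed.

Lemma periodic_derive (g g' : R -> R) P : (forall x, is_derive g x (g' x)) ->
  (forall x, g (x + P) = g x) -> forall x, g' (x + P) = g' x.
Proof.
  intros Hg Hp x.
  assert (H : is_derive (fun t => g (t + P)) x (g' (x + P))).
  { rewrite <- (Rmult_1_l (g' (x + P))).
    apply (is_derive_comp g (fun t => t + P)); [apply Hg | auto_derive; auto]. }
  apply is_derive_unique in H. rewrite <- H.
  rewrite (Derive_ext _ g) by auto. now apply is_derive_unique.
Qed.

Lemma periodic_monotone_derive (g g' : R -> R) P : 0 < P -> (forall x, is_derive g x (g' x)) ->
  (forall x, g (x + P) = g x) -> (forall x, 0 <= g' x) -> forall x, g' x = 0.
Proof.
  intros HP Hg Hp Hpos.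
  assert (Hmon : forall x y, x <= y -> g x <= g y).
  { intros x y Hxy. destruct (MVT_gen g x y g') as [c [Hc Heq]].
    - intros t _. apply Hg.
    - intros t _. apply derivable_continuous_pt. exists (g' t). apply is_derive_Reals, Hg.
    - assert (Hc' := Hpos c). nra. }
  assert (Hconst : forall x, is_derive g x 0).
  (* Near [x], monotonicity puts [g] between [g (x - P / 2)] and [g (x + P / 2)], which are
     equal. *)
  { intros x. apply (is_derive_ext_loc (fun _ => g (x - P / 2))).
    - exists (mkposreal (P / 2) ltac:(lra)). intros y Hy. apply Rabs_lt_between' in Hy. simpl in Hy.
      apply Rle_antisym; [apply Hmon; lra|].
      rewrite <- (Hp (x - P / 2)). apply Hmon. lra.
    - apply (is_derive_const (V := R_NormedModule) (g (x - P / 2))). }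
  intros x. rewrite <- (is_derive_unique _ _ _ (Hg x)). now apply is_derive_unique.
Qed.

(** The periodic function [g g'] has derivative [g'^2 - mu g^2 >= 0], which must therefore
    vanish. *)
Lemma periodic_ode_neg (g g' : R -> R) mu P : 0 < P -> mu < 0 ->
  (forall x, is_derive g x (g' x)) -> (forall x, is_derive g' x (- mu * g x)) ->
  (forall x, g (x + P) = g x) -> forall x, g x = 0.
Proof.
  intros HP Hmu Hg Hg' Hp.
  assert (Hp' := periodic_derive g g' P Hg Hp).
  assert (H := periodic_monotone_derive (fun x => g x * g' x)
    (fun x => g' x * g' x + g x * (- mu * g x)) P HP).
  assert (H0 : forall x, g' x * g' x + g x * (- mu * g x) = 0).
  { apply H.
    - intros x. apply (is_derive_mult g g'); auto. intros; apply Rmult_comm.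
    - intros x. now rewrite Hp, Hp'.
    - intros x. assert (0 <= g x * g x) by apply Rle_0_sqr.
      assert (0 <= g' x * g' x) by apply Rle_0_sqr. nra. }
  intros x. specialize (H0 x).
  assert (0 <= g x * g x) by apply Rle_0_sqr. assert (0 <= g' x * g' x) by apply Rle_0_sqr.
  assert (Hsq : g x * g x = 0) by nra. apply Rmult_integral in Hsq. tauto.
Qed.

Lemma periodic_ode_zero (g g' : R -> R) P : 0 < P ->
  (forall x, is_derive g x (g' x)) -> (forall x, is_derive g' x 0) ->
  (forall x, g (x + P) = g x) -> forall x, g x = g 0.
Proof.
  intros HP Hg Hg' Hp.
  assert (Hc := constant_of_zero_derive g' Hg').
  assert (Hz : g' 0 = 0).
  { destruct (MVT_gen g 0 P g') as [c [_ Heq]].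
    - intros t _. apply Hg.
    - intros t _. apply derivable_continuous_pt. exists (g' t). apply is_derive_Reals, Hg.
    - rewrite <- (Rplus_0_l P), Hp, (Hc c 0) in Heq. nra. }
  intros x. apply constant_of_zero_derive. intros t. rewrite <- Hz, (Hc 0 t). apply Hg.
Qed.

(** Solutions are combinations [A cos + B sin] of frequency [sqrt mu]. Translation by the period
    rotates [(A, B)] by the angle [th], and a rotation fixing a nonzero vector is trivial, so
    [a sqrt mu] is an integer. *)
Lemma periodic_ode_pos (g g' : R -> R) mu a : 0 < a -> 0 < mu ->
  (forall x, is_derive g x (g' x)) -> (forall x, is_derive g' x (- mu * g x)) ->
  (forall x, g (x + 2 * PI * a) = g x) ->
  (forall x, g x = 0) \/ exists k : nat, mu * a ^ 2 = INR k * INR k.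
Proof.
  intros Ha Hmu Hg Hg' Hp.
  set (om := sqrt mu).
  assert (Hom : 0 < om) by now apply sqrt_lt_R0.
  assert (Hom2 : om * om = mu) by (apply sqrt_sqrt; lra).
  set (A := g 0). set (B := g' 0 / om).
  assert (Hsol : forall x, g x - (A * cos (om * x) + B * sin (om * x)) = 0).
  { apply (ode_unique _ (fun x => g' x - (- A * om * sin (om * x) + B * om * cos (om * x))) mu); auto.
    - intros x. apply (is_derive_minus g); [apply Hg | auto_derive; auto; ring].
    - intros x.
      replace (- mu * (g x - (A * cos (om * x) + B * sin (om * x))))
        with (- mu * g x - (- A * (om * om) * cos (om * x) - B * (om * om) * sin (om * x)))
        by (rewrite Hom2; ring).
      apply (is_derive_minus g'); [apply Hg' | auto_derive; auto; ring].
    - rewrite Rmult_0_r, cos_0, sin_0. unfold A. ring.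
    - rewrite Rmult_0_r, cos_0, sin_0. unfold B. field. lra. }
  assert (Hg2 : forall x, g x = A * cos (om * x) + B * sin (om * x))
    by (intros x; specialize (Hsol x); lra).
  assert (Hg'2 : forall x, g' x = - A * om * sin (om * x) + B * om * cos (om * x)).
  { intros x. rewrite <- (is_derive_unique _ _ _ (Hg x)).
    rewrite (Derive_ext _ _ x Hg2). apply is_derive_unique. auto_derive; auto. ring. }
  set (th := om * (2 * PI * a)).
  assert (E1 : A * cos th + B * sin th = A).
  { unfold th. rewrite <- Hg2. rewrite <- (Rplus_0_l (2 * PI * a)), Hp. reflexivity. }
  assert (E2 : - A * sin th + B * cos th = B).
  { assert (H := Hg'2 (2 * PI * a)). fold th in H.
    rewrite <- (Rplus_0_l (2 * PI * a)), (periodic_derive g g' _ Hg Hp) in H.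
    unfold B at 2. apply (Rmult_eq_reg_r om); [|lra]. unfold Rdiv.
    rewrite Rmult_assoc, Rinv_l by lra. lra. }
  destruct (Req_dec (A * A + B * B) 0) as [Hz|Hnz].
  - left. intros x. rewrite Hg2.
    assert (A = 0) by nra. assert (B = 0) by nra. rewrite H, H0. ring.
  - right.
    assert (Hcos : cos th = 1).
    { apply (Rmult_eq_reg_l (A * A + B * B)); auto.
      replace ((A * A + B * B) * cos th)
        with (A * (A * cos th + B * sin th) + B * (- A * sin th + B * cos th)) by ring.
      rewrite E1, E2. ring. }
    assert (Hsin : sin (om * PI * a) = 0).
    { assert (Hd := cos_2a_sin (om * PI * a)).
      replace (2 * (om * PI * a)) with th in Hd by (unfold th; ring). nra. }
    apply sin_eq_0_0 in Hsin. destruct Hsin as [k Hk].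
    assert (Hpi := PI_RGT_0).
    assert (Hk' : om * a = IZR k) by (apply (Rmult_eq_reg_r PI); lra).
    assert (Hkpos : (0 <= k)%Z).
    { apply le_IZR. rewrite <- Hk'. nra. }
    exists (Z.to_nat k). rewrite INR_IZR_INZ, Z2Nat.id, <- Hk', <- Hom2 by auto. ring.
Qed.

(** * Functions orthogonal to all trigonometric polynomials *)

Lemma ex_RInt_of_continuous (f : R -> R) u v : (forall x, continuous f x) -> ex_RInt f u v.
Proof. intros H. apply (ex_RInt_continuous (V := R_CompleteNormedModule)). auto. Qed.

Lemma RInt_shift_periodic (h : R -> R) P s : (forall x, continuous h x) ->
  (forall x, h (x + P) = h x) -> RInt h s (s + P) = RInt h 0 P.
Proof.
  intros Hc Hp.
  assert (Hex : forall u v, ex_RInt h u v) by (intros; now apply ex_RInt_of_continuous).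
  assert (E1 := RInt_Chasles h s 0 P (Hex _ _) (Hex _ _)).
  assert (E2 := RInt_Chasles h s P (s + P) (Hex _ _) (Hex _ _)).
  assert (E3 := opp_RInt_swap h 0 s (Hex _ _)).
  assert (E4 : RInt h P (s + P) = RInt h 0 s).
  { assert (E := RInt_comp_lin h 1 P 0 s).
    replace (1 * 0 + P) with P in E by ring. replace (1 * s + P) with (s + P) in E by ring.
    rewrite <- E by auto. apply RInt_ext. intros x _. unfold scal; simpl. unfold mult; simpl.
    rewrite Rmult_1_l, Rmult_1_l. apply Hp. }
  unfold plus, opp in *; simpl in *. lra.
Qed.

Lemma continuous_cos_affine al be y : continuous (fun t => cos (al * t + be)) y.
Proof. apply (ex_derive_continuous (fun t => cos (al * t + be))). auto_derive; auto. Qed.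

Lemma continuous_Rmult (f g : R -> R) x : continuous f x -> continuous g x ->
  continuous (fun t => f t * g t) x.
Proof. apply (continuous_mult (K := R_AbsRing)). Qed.

(** The arbitrary phase [b] treats cosines and sines at once and makes the condition stable under
    multiplication by [cos (y / a + b0)], by the product-to-sum formula. *)
Definition trig_orth (a : R) (f : R -> R) : Prop :=
  forall (l : Z) (b : R), RInt (fun y => f y * cos (IZR l / a * y + b)) 0 (2 * PI * a) = 0 :> R.

Lemma RInt_comb (f g h : R -> R) c d u v : (forall x, continuous f x) -> (forall x, continuous g x) ->
  (forall x, h x = c * f x + d * g x) -> RInt h u v = c * RInt f u v + d * RInt g u v :> R.
Proof.
  intros Hf Hg Hh.
  assert (Ef : ex_RInt f u v) by now apply ex_RInt_of_continuous.
  assert (Eg : ex_RInt g u v) by now apply ex_RInt_of_continuous.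
  apply is_RInt_unique.
  apply (is_RInt_ext (fun x => plus (scal c (f x)) (scal d (g x)))).
  - intros x _. symmetry. apply Hh.
  - apply (is_RInt_plus (V := R_NormedModule)); apply (is_RInt_scal (V := R_NormedModule));
      now apply (RInt_correct (V := R_CompleteNormedModule)).
Qed.

Lemma trig_orth_step a (f : R -> R) c b0 : a <> 0 -> (forall x, continuous f x) -> trig_orth a f ->
  trig_orth a (fun y => f y * (c + cos (1 / a * y + b0))).
Proof.
  intros Ha Hf H l b.
  assert (Hc : forall l b x, continuous (fun y => f y * cos (IZR l / a * y + b)) x).
  { intros. apply continuous_Rmult; auto. apply continuous_cos_affine. }
  set (f1 := fun y => f y * cos (IZR l / a * y + b)).
  set (f2 := fun y => f y * cos (IZR (l + 1) / a * y + (b + b0))).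
  set (f3 := fun y => f y * cos (IZR (l - 1) / a * y + (b - b0))).
  assert (H23 : RInt (fun y => / 2 * f2 y + / 2 * f3 y) 0 (2 * PI * a) = 0 :> R).
  { rewrite (RInt_comb f2 f3 _ (/ 2) (/ 2)); [|intros; apply Hc|intros; apply Hc|auto].
    unfold f2, f3. rewrite !H. ring. }
  rewrite (RInt_comb f1 (fun y => / 2 * f2 y + / 2 * f3 y) _ c 1).
  - rewrite H23. unfold f1. rewrite H. ring.
  - intros; apply Hc.
  - intros x. apply (continuous_plus (V := R_NormedModule));
      apply continuous_Rmult; try apply continuous_const; apply Hc.
  - intros x. unfold f1, f2, f3. rewrite plus_IZR, minus_IZR.
    set (u := IZR l / a * x + b). set (v := 1 / a * x + b0).
    replace ((IZR l + 1) / a * x + (b + b0)) with (u + v) by (unfold u, v; field; auto).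
    replace ((IZR l - 1) / a * x + (b - b0)) with (u - v) by (unfold u, v; field; auto).
    rewrite cos_plus, cos_minus. field.
Qed.

Lemma trig_orth_pow a (f : R -> R) c b0 n : a <> 0 -> (forall x, continuous f x) -> trig_orth a f ->
  trig_orth a (fun y => f y * (c + cos (1 / a * y + b0)) ^ n) /\
  forall x, continuous (fun y => f y * (c + cos (1 / a * y + b0)) ^ n) x.
Proof.
  intros Ha Hf H.
  assert (Hq : forall x, continuous (fun y => c + cos (1 / a * y + b0)) x).
  { intros x. apply (continuous_plus (V := R_NormedModule)); [apply continuous_const|].
    apply continuous_cos_affine. }
  induction n as [|n [IH IHc]].
  - simpl. split.
    + intros l b. transitivity (RInt (fun y => f y * cos (IZR l / a * y + b)) 0 (2 * PI * a)); auto.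
      apply RInt_ext. intros. now rewrite Rmult_1_r.
    + intros x. apply continuous_Rmult; auto. apply continuous_const.
  - assert (E : (fun y => f y * (c + cos (1 / a * y + b0)) ^ S n)
      = (fun y => f y * (c + cos (1 / a * y + b0)) ^ n * (c + cos (1 / a * y + b0)))).
    { extensionality y. simpl. ring. }
    split; [rewrite E|].
    + apply (trig_orth_step a (fun y => f y * (c + cos (1 / a * y + b0)) ^ n)); auto.
    + intros x.
      apply (continuous_ext (fun y => f y * (c + cos (1 / a * y + b0)) ^ n * (c + cos (1 / a * y + b0)))).
      { intros y. simpl. ring. }
      apply (continuous_Rmult (fun y => f y * (c + cos (1 / a * y + b0)) ^ n)); auto.
Qed.

Lemma cos_periodic_a a y b : 0 < a -> cos (1 / a * (y + 2 * PI * a) + b) = cos (1 / a * y + b).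
Proof.
  intros Ha. replace (1 / a * (y + 2 * PI * a) + b) with (1 / a * y + b + 2 * INR 1 * PI)
    by (simpl; field; lra). apply cos_period.
Qed.

(* If [f y0 > 0], the integrals of [f] against powers of the trigonometric polynomial
   [1 - cos d + cos ((y - y0) / a)], which exceeds 1 exactly near [y0], are unbounded. *)
Lemma trig_orth_nonpos a (f : R -> R) : 0 < a -> (forall x, continuous f x) ->
  (forall x, f (x + 2 * PI * a) = f x) -> trig_orth a f -> forall y0, f y0 <= 0.
Proof.
  intros Ha Hc Hp Ho y0. apply Rnot_lt_le. intros Hy0.
  assert (Hpi := PI_RGT_0).
  set (m := f y0) in *.
  assert (Hnear : exists d, 0 < d < PI / 2 /\ forall y, Rabs (y - y0) < d * a -> m / 2 < f y).
  { assert (Hl := proj1 (filterlim_locally f (f y0)) (Hc y0) (mkposreal (m / 2) ltac:(lra))).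
    destruct Hl as [e He].
    exists (Rmin (PI / 4) (e / a)).
    assert (Hea : 0 < e / a) by (apply Rdiv_lt_0_compat; [apply cond_pos | lra]).
    split.
    - split; [apply Rmin_glb_lt; lra|]. eapply Rle_lt_trans; [apply Rmin_l|]. lra.
    - intros y Hy.
      assert (Hye : Rabs (y - y0) < e).
      { eapply Rlt_le_trans; [exact Hy|].
        apply Rle_trans with (e / a * a); [apply Rmult_le_compat_r; [lra | apply Rmin_r]|].
        right. field. lra. }
      specialize (He y Hye). apply Rabs_lt_between' in He. simpl in He. fold m in He. lra. }
  destruct Hnear as [d [Hd Hnear]].
  (* [M] bounds [|f|] on a full period around [y0]. *)
  destruct (continuity_ab_maj (fun y => Rabs (f y)) (y0 - PI * a) (y0 + PI * a)) as [z [Hz _]].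
  { nra. }
  { intros c _. apply continuity_pt_filterlim.
    apply (continuous_comp f Rabs); [apply Hc | apply continuous_Rabs]. }
  set (M := Rabs (f z)) in *.
  set (c := 1 - cos d).
  set (Q := fun y => c + cos (1 / a * y + - (y0 / a))).
  set (eta := cos (d / 2) - cos d).
  assert (Heta : 0 < eta).
  { apply Rlt_0_minus. apply cos_decreasing_1; lra. }
  assert (Hcd : 0 < cos d) by (apply cos_gt_0; lra).
  assert (HQ : forall y, Q y = c + cos (Rabs (y - y0) / a)).
  { intros y. unfold Q. f_equal. unfold Rabs. destruct (Rcase_abs (y - y0)).
    - rewrite <- cos_neg. f_equal. field. lra.
    - f_equal. field. lra. }
  (* Even powers keep the kernel nonnegative where [Q] is negative. *)
  assert (Hint : forall k : nat, RInt (fun y => f y * Q y ^ (2 * k)) (y0 - PI * a) (y0 + PI * a) = 0 :> R).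
  { intros k.
    destruct (trig_orth_pow a f c (- (y0 / a)) (2 * k) ltac:(lra) Hc Ho) as [Hk Hkc].
    replace (y0 + PI * a) with (y0 - PI * a + 2 * PI * a) by ring.
    rewrite RInt_shift_periodic.
    - refine (eq_trans _ (Hk 0%Z 0)). apply RInt_ext. intros x _.
      replace (IZR 0 / a * x + 0) with 0 by (unfold Rdiv; ring). now rewrite cos_0, Rmult_1_r.
    - exact Hkc.
    - intros x. unfold Q. now rewrite Hp, cos_periodic_a. }
  assert (HQc : forall k x, continuous (fun y => Q y ^ k) x).
  { intros k x. apply (ex_derive_continuous (fun y => Q y ^ k)). unfold Q. auto_derive; auto. }
  assert (HQpos : forall k y, 0 <= Q y ^ (2 * k)).
  { intros k y. rewrite pow_mult. apply pow_le. simpl. rewrite Rmult_1_r. apply Rle_0_sqr. }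
  (* Near [y0], [f > m / 2]; elsewhere on the period [f >= - M] and [Q^(2 k) <= 1]. *)
  assert (Hpt : forall k y, y0 - PI * a < y < y0 + PI * a ->
    m / 2 * Q y ^ (2 * k) + - (M + m / 2) * 1 <= f y * Q y ^ (2 * k)).
  { intros k y Hy. assert (H0 := HQpos k y). assert (HM0 : 0 <= M) by apply Rabs_pos.
    destruct (Rlt_le_dec (Rabs (y - y0)) (d * a)) as [Hin|Hout].
    - apply Hnear in Hin. nra.
    - assert (Hlow : - M <= f y).
      { assert (H1 := Hz y ltac:(lra)). apply Rabs_le_between in H1. lra. }
      assert (Hang : d <= Rabs (y - y0) / a <= PI).
      { split; [apply Rle_div_r; lra|]. apply Rle_div_l; auto. apply Rabs_le. lra. }
      assert (Hcos : cos (Rabs (y - y0) / a) <= cos d).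
      { destruct (Req_dec d (Rabs (y - y0) / a)) as [->|]; [lra|].
        apply Rlt_le, cos_decreasing_1; lra. }
      assert (Hb := COS_bound (Rabs (y - y0) / a)). assert (Hb' := COS_bound d).
      assert (H1 : Q y ^ (2 * k) <= 1).
      { rewrite pow_mult. rewrite <- (pow1 k). apply pow_incr. rewrite HQ. unfold c.
        split; [apply pow2_ge_0|]. set (q := 1 - cos d + cos (Rabs (y - y0) / a)).
        assert (Hq : -1 <= q <= 1) by (unfold q; lra). clearbody q. nra. }
      nra. }
  (* On the inner interval of length [d a], [Q >= 1 + eta], and Bernoulli's inequality gives growth
     linear in [k]. *)
  assert (Hlow : forall k : nat, d * a * (1 + INR (2 * k) * eta)
     <= RInt (fun y => Q y ^ (2 * k)) (y0 - PI * a) (y0 + PI * a)).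
  { intros k.
    assert (Hex : forall u v, ex_RInt (fun y => Q y ^ (2 * k)) u v)
      by (intros; apply ex_RInt_of_continuous; apply HQc).
    rewrite <- (RInt_Chasles _ (y0 - PI * a) (y0 - d / 2 * a)) by auto.
    rewrite <- (RInt_Chasles _ (y0 - d / 2 * a) (y0 + d / 2 * a) (y0 + PI * a)) by auto.
    assert (G1 : 0 <= RInt (fun y => Q y ^ (2 * k)) (y0 - PI * a) (y0 - d / 2 * a))
      by (apply RInt_ge_0; auto; nra).
    assert (G2 : 0 <= RInt (fun y => Q y ^ (2 * k)) (y0 + d / 2 * a) (y0 + PI * a))
      by (apply RInt_ge_0; auto; nra).
    assert (G3 : RInt (fun _ => 1 + INR (2 * k) * eta) (y0 - d / 2 * a) (y0 + d / 2 * a)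
      <= RInt (fun y => Q y ^ (2 * k)) (y0 - d / 2 * a) (y0 + d / 2 * a)).
    { apply RInt_le; auto; [nra | apply ex_RInt_const |].
      intros y Hy. apply Rle_trans with ((1 + eta) ^ (2 * k)); [now apply poly|].
      apply pow_incr. split; [lra|]. rewrite HQ. unfold c, eta.
      assert (Hang : 0 <= Rabs (y - y0) / a <= d / 2).
      { split; [apply Rdiv_le_0_compat; [apply Rabs_pos | auto]|].
        apply Rle_div_l; auto. apply Rabs_le. lra. }
      assert (cos (d / 2) <= cos (Rabs (y - y0) / a)); [|lra].
      destruct (Req_dec (Rabs (y - y0) / a) (d / 2)) as [->|]; [lra|].
      apply Rlt_le, cos_decreasing_1; lra. }
    rewrite RInt_const in G3. revert G1 G2 G3.
    generalize (RInt (fun y => Q y ^ (2 * k)) (y0 - PI * a) (y0 - d / 2 * a))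
      (RInt (fun y => Q y ^ (2 * k)) (y0 - d / 2 * a) (y0 + d / 2 * a))
      (RInt (fun y => Q y ^ (2 * k)) (y0 + d / 2 * a) (y0 + PI * a)).
    intros r1 r2 r3 G1 G2 G3. change (d * a * (1 + INR (2 * k) * eta) <= r1 + (r2 + r3)).
    change ((y0 + d / 2 * a - (y0 - d / 2 * a)) * (1 + INR (2 * k) * eta) <= r2) in G3.
    replace (y0 + d / 2 * a - (y0 - d / 2 * a)) with (d * a) in G3 by field. lra. }
  assert (Hall : forall k : nat, m / 2 * (d * a * (1 + INR (2 * k) * eta))
      <= 2 * PI * a * (M + m / 2)).
  { intros k.
    assert (Hle : RInt (fun y => m / 2 * Q y ^ (2 * k) + - (M + m / 2) * 1)
       (y0 - PI * a) (y0 + PI * a) <= RInt (fun y => f y * Q y ^ (2 * k)) (y0 - PI * a) (y0 + PI * a)).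
    { apply RInt_le; [nra | | | auto]; apply ex_RInt_of_continuous; intros x.
      - apply (continuous_plus (V := R_NormedModule)); [|apply continuous_const].
        apply continuous_Rmult; [apply continuous_const | apply HQc].
      - apply continuous_Rmult; [apply Hc | apply HQc]. }
    rewrite Hint in Hle.
    rewrite (RInt_comb (fun y => Q y ^ (2 * k)) (fun _ => 1) _ (m / 2) (- (M + m / 2))) in Hle;
      [| apply HQc | intros; apply continuous_const | auto].
    rewrite RInt_const in Hle. specialize (Hlow k). revert Hle Hlow.
    generalize (RInt (fun y => Q y ^ (2 * k)) (y0 - PI * a) (y0 + PI * a)). intros r Hle Hlow.
    change (m / 2 * r + - (M + m / 2) * ((y0 + PI * a - (y0 - PI * a)) * 1) <= 0) in Hle.
    apply Rle_trans with (m / 2 * r); [apply Rmult_le_compat_l; lra | lra]. }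
  set (C := 2 * PI * a * (M + m / 2)) in *.
  assert (Hs : 0 < m / 2 * (d * a * eta)).
  { apply Rmult_lt_0_compat; [lra|]. apply Rmult_lt_0_compat; nra. }
  destruct (archimed_cor1 (m / 2 * (d * a * eta) / (Rabs C + 1))) as [k [Hk Hk0]].
  { apply Rdiv_lt_0_compat; auto. assert (H := Rabs_pos C). lra. }
  assert (HkR : 0 < INR k) by now apply lt_0_INR.
  assert (HC : Rabs C + 1 < m / 2 * (d * a * eta) * INR k).
  { assert (HC0 := Rabs_pos C).
    apply (Rmult_lt_compat_r (INR k * (Rabs C + 1))) in Hk; [|nra].
    replace (/ INR k * (INR k * (Rabs C + 1))) with (Rabs C + 1) in Hk by (field; lra).
    replace (m / 2 * (d * a * eta) / (Rabs C + 1) * (INR k * (Rabs C + 1)))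
      with (m / 2 * (d * a * eta) * INR k) in Hk by (field; lra). exact Hk. }
  specialize (Hall k). rewrite mult_INR in Hall. simpl INR in Hall at 1.
  assert (HCa := Rle_abs C).
  assert (0 < m / 2 * (d * a)) by (apply Rmult_lt_0_compat; nra).
  assert (0 < m / 2 * (d * a * eta) * INR k) by nra.
  replace (m / 2 * (d * a * (1 + (1 + 1) * INR k * eta))) with
    (m / 2 * (d * a) + 2 * (m / 2 * (d * a * eta) * INR k)) in Hall by ring.
  lra.
Qed.

Lemma trig_orth_zero a (f : R -> R) : 0 < a -> (forall x, continuous f x) ->
  (forall x, f (x + 2 * PI * a) = f x) -> trig_orth a f -> forall y, f y = 0.
Proof.
  intros Ha Hc Hp Ho y. apply Rle_antisym; [now apply (trig_orth_nonpos a)|].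
  assert (H : - f y <= 0); [|lra].
  apply (trig_orth_nonpos a (fun y => - f y)); auto.
  - intros x. apply (continuous_opp (V := R_NormedModule)), Hc.
  - intros x. now rewrite Hp.
  - intros l b.
    assert (Hcl : forall x, continuous (fun y => f y * cos (IZR l / a * y + b)) x).
    { intros x. apply continuous_Rmult; [apply Hc | apply continuous_cos_affine]. }
    rewrite (RInt_comb _ _ _ (-1) 0 _ _ Hcl Hcl) by (intros; ring).
    rewrite Ho. ring.
Qed.

(** * Eigenfunctions on the square torus *)

(* Hartley's kernel: the functions [cas (l y / a)], [l] in Z, form a real orthogonal basis
   indexed by all of Z, so that frequencies are counted exactly as in [r2]. *)
Definition cas (t : R) : R := cos t + sin t.

Definition coef (a : R) (G : vfun) (i : nat) (l : Z) (x : R) : R :=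
  RInt (fun y => G x y i * cas (IZR l / a * y)) 0 (2 * PI * a).

Lemma smooth_continuous_y n G i x y : smooth_on n G -> (i <= n)%nat ->
  continuous (fun t => G x t i) y.
Proof.
  intros H Hi. apply (ex_derive_continuous (fun t => G x t i)). apply (H nil i Hi x y).
Qed.

Lemma continuous_cas_lin al y : continuous (fun t => cas (al * t)) y.
Proof.
  apply (ex_derive_continuous (fun t => cas (al * t))). unfold cas. auto_derive; auto.
Qed.

Lemma continuous_coef_integrand n a G i l x y : smooth_on n G -> (i <= n)%nat ->
  continuous (fun t => G x t i * cas (IZR l / a * t)) y.
Proof.
  intros H Hi. apply continuous_Rmult; [now apply (smooth_continuous_y n)|].
  apply continuous_cas_lin.
Qed.

(** [cas] at [l] and at [- l] spans the cosine and the sine of frequency [l], so the slice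
    [y -> G x y i] satisfies [trig_orth]. *)
Lemma coef_injective n a G i x : 0 < a -> smooth_on n G -> (i <= n)%nat ->
  (forall y, G x (y + 2 * PI * a) i = G x y i) ->
  (forall l, coef a G i l x = 0) -> forall y, G x y i = 0.
Proof.
  intros Ha H Hi Hp Hz. apply (trig_orth_zero a (fun y => G x y i)); auto.
  - intros y. now apply (smooth_continuous_y n).
  - intros l b.
    rewrite (RInt_comb (fun t => G x t i * cas (IZR l / a * t))
      (fun t => G x t i * cas (IZR (- l) / a * t)) _
      ((cos b - sin b) / 2) ((cos b + sin b) / 2)).
    + fold (coef a G i l x) (coef a G i (- l) x). rewrite !Hz. ring.
    + intros. now apply (continuous_coef_integrand n).
    + intros. now apply (continuous_coef_integrand n).
    + intros y. unfold cas. rewrite opp_IZR.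
      replace (- IZR l / a * y) with (- (IZR l / a * y)) by (field; lra).
      rewrite cos_neg, sin_neg, cos_plus. field.
Qed.

Lemma coef_derive n a G i l x : smooth_on n G -> (i <= n)%nat ->
  is_derive (coef a G i l) x (coef a (dX G) i l x).
Proof.
  intros H Hi. unfold coef.
  assert (D : forall u v, is_derive (fun z => G z v i * cas (IZR l / a * v)) u
    (dX G u v i * cas (IZR l / a * v))).
  { intros u v.
    apply (is_derive_ext (fun z => scal (cas (IZR l / a * v)) (G z v i))).
    - intros. apply Rmult_comm.
    - rewrite (Rmult_comm (dX G u v i)). apply is_derive_scal. eapply is_derive_dX; eauto. }
  rewrite (RInt_ext _ (fun t => Derive (fun u => G u t i * cas (IZR l / a * t)) x)).
  - apply (is_derive_RInt_param (fun u t => G u t i * cas (IZR l / a * t))).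
    + apply filter_forall. intros u t _. eexists. apply D.
    + intros t _.
      apply (continuity_2d_pt_ext (fun u v => dX G u v i * cas (IZR l / a * v))).
      { intros u v. symmetry. apply is_derive_unique, D. }
      apply continuity_2d_pt_mult.
      * apply continuity_2d_of_continuous. apply (H (true :: nil) i Hi x t).
      * apply (continuity_1d_2d_pt_comp (fun v => cas (IZR l / a * v)) (fun u v => v)).
        -- apply continuity_pt_filterlim, continuous_cas_lin.
        -- apply continuity_2d_pt_id2.
    + apply filter_forall. intros u. apply ex_RInt_of_continuous.
      intros. now apply (continuous_coef_integrand n).
  - intros t _. symmetry. apply is_derive_unique, D.
Qed.

(* Twofold integration by parts in [y]. *)
Lemma coef_dYdY n a G i l x : 0 < a -> smooth_on n G -> (i <= n)%nat ->
  (forall y, G x (y + 2 * PI * a) i = G x y i) ->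
  coef a (dY (dY G)) i l x = - (IZR l / a * (IZR l / a)) * coef a G i l x.
Proof.
  intros Ha H Hi Hp. set (om := IZR l / a).
  assert (HY := smooth_dY n G H). assert (HYY := smooth_dY n _ HY).
  set (cas' := fun t => cos t - sin t).
  (* Up to sign the Wronskian of [G] and [cas] in [y]; it takes equal values at both ends of the
     period, so its derivative [w] integrates to zero. *)
  set (W := fun y => dY G x y i * cas (om * y) - G x y i * (om * cas' (om * y))).
  set (w := fun y => 1 * (dY (dY G) x y i * cas (om * y)) + om * om * (G x y i * cas (om * y))).
  assert (DW : forall y, is_derive W y (w y)).
  { intros y. unfold W, w.
    replace (1 * (dY (dY G) x y i * cas (om * y)) + om * om * (G x y i * cas (om * y)))
      with ((dY (dY G) x y i * cas (om * y) + dY G x y i * (om * cas' (om * y)))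
         - (dY G x y i * (om * cas' (om * y)) + G x y i * (om * - (om * cas (om * y))))) by ring.
    apply (is_derive_minus (fun y => dY G x y i * cas (om * y))).
    - apply (is_derive_mult (fun y => dY G x y i) (fun y => cas (om * y))).
      + now apply (is_derive_dY n).
      + unfold cas, cas'. auto_derive; auto. ring.
      + intros; apply Rmult_comm.
    - apply (is_derive_mult (fun y => G x y i) (fun y => om * cas' (om * y))).
      + now apply (is_derive_dY n).
      + unfold cas, cas'. auto_derive; auto. ring.
      + intros; apply Rmult_comm. }
  assert (Cw : forall y, continuous w y).
  { intros y. unfold w. apply (continuous_plus (V := R_NormedModule)).
    - apply (continuous_Rmult (fun _ => 1)); [apply continuous_const|].
      now apply (continuous_coef_integrand n).
    - apply (continuous_Rmult (fun _ => om * om)); [apply continuous_const|].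
      now apply (continuous_coef_integrand n). }
  assert (HW := is_RInt_derive (V := R_CompleteNormedModule) W w 0 (2 * PI * a)
    (fun y _ => DW y) (fun y _ => Cw y)).
  apply is_RInt_unique in HW.
  rewrite (RInt_comb (fun y => dY (dY G) x y i * cas (om * y)) (fun y => G x y i * cas (om * y))
    w 1 (om * om)) in HW.
  2:{ intros; now apply (continuous_coef_integrand n). }
  2:{ intros; now apply (continuous_coef_integrand n). }
  2:{ reflexivity. }
  assert (Hend : W (2 * PI * a) = W 0).
  { unfold W. rewrite <- (Rplus_0_l (2 * PI * a)).
    assert (Hpy : dY G x (0 + 2 * PI * a) i = dY G x 0 i).
    { apply (periodic_derive (fun t => G x t i) (fun t => dY G x t i)); auto.
      intros t. now apply (is_derive_dY n). }
    rewrite Hpy, Hp.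
    assert (Hang : cos (om * (0 + 2 * PI * a)) = cos (om * 0) /\
                   sin (om * (0 + 2 * PI * a)) = sin (om * 0)).
    { replace (om * (0 + 2 * PI * a)) with (2 * (IZR l * PI)) by (unfold om; field; lra).
      rewrite Rmult_0_r, cos_0, sin_0, cos_2a_sin, sin_2a.
      rewrite (sin_eq_0_1 (IZR l * PI)) by (now exists l). split; ring. }
    unfold cas, cas'. destruct Hang as [-> ->]. reflexivity. }
  assert (HW0 : 1 * coef a (dY (dY G)) i l x + om * om * coef a G i l x = 0).
  { refine (eq_trans HW _). rewrite Hend. apply (minus_eq_zero (W 0)). }
  lra.
Qed.

(** Each coefficient in [y] satisfies [g'' = - mu g] with [mu = lam - l^2 / a^2], periodically in
    [x]. For [mu < 0] it vanishes, for [mu = 0] it is constant, for [mu > 0] it vanishes unless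
    [mu a^2 = k^2]; the hypothesis removes the initial data in the surviving cases. *)
Lemma eigenfunction_zero n a G i lam : 0 < a -> smooth_on n G -> (i <= n)%nat ->
  (forall x y, G (x + 2 * PI * a) y i = G x y i /\ G x (y + 2 * PI * a) i = G x y i) ->
  (forall x y, lap G x y i = - lam * G x y i) ->
  (forall (l : Z) (k : nat), lam * a ^ 2 = INR k * INR k + IZR l * IZR l ->
     coef a G i l 0 = 0 /\ ((0 < k)%nat -> coef a (dX G) i l 0 = 0)) ->
  forall x y, G x y i = 0.
Proof.
  intros Ha H Hi Hp Hlap Hz x.
  assert (HX := smooth_dX n G H). assert (HXX := smooth_dX n _ HX).
  assert (HY := smooth_dY n G H). assert (HYY := smooth_dY n _ HY).
  assert (Hpi := PI_RGT_0). assert (HP : 0 < 2 * PI * a) by nra.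
  apply (coef_injective n a); auto; [intros; apply Hp|].
  intros l. revert x.
  set (mu := lam - IZR l / a * (IZR l / a)).
  assert (D1 : forall x, is_derive (coef a G i l) x (coef a (dX G) i l x))
    by (intros; now apply (coef_derive n)).
  assert (D2 : forall x, is_derive (coef a (dX G) i l) x (- mu * coef a G i l x)).
  { intros x. replace (- mu * coef a G i l x) with (coef a (dX (dX G)) i l x);
      [now apply (coef_derive n)|].
    assert (E := RInt_comb (fun y => G x y i * cas (IZR l / a * y))
      (fun y => dY (dY G) x y i * cas (IZR l / a * y))
      (fun y => dX (dX G) x y i * cas (IZR l / a * y)) (- lam) (-1) 0 (2 * PI * a)).
    unfold coef at 1. rewrite E.
    - fold (coef a G i l x) (coef a (dY (dY G)) i l x).
      rewrite (coef_dYdY n); auto; [unfold mu; ring | intros; apply Hp].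
    - intros; now apply (continuous_coef_integrand n).
    - intros; now apply (continuous_coef_integrand n).
    - intros y. specialize (Hlap x y). unfold lap in Hlap.
      replace (dX (dX G) x y i) with (- lam * G x y i - dY (dY G) x y i) by lra. ring. }
  assert (Hper : forall x, coef a G i l (x + 2 * PI * a) = coef a G i l x).
  { intros x. apply RInt_ext. intros y _. f_equal. apply Hp. }
  assert (Hmu : mu * a ^ 2 = lam * a ^ 2 - IZR l * IZR l) by (unfold mu; field; lra).
  destruct (Rtotal_order mu 0) as [Hneg|[Hzero|Hpos]].
  - now apply (periodic_ode_neg _ (coef a (dX G) i l) mu (2 * PI * a)).
  - intros x. rewrite (periodic_ode_zero _ (coef a (dX G) i l) (2 * PI * a)); auto.
    + apply (Hz l 0%nat). simpl. rewrite Hzero in Hmu. lra.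
    + intros t. replace 0 with (- mu * coef a G i l t) by (rewrite Hzero; ring). apply D2.
  - destruct (periodic_ode_pos _ _ mu a Ha Hpos D1 D2 Hper) as [|[k Hk]]; auto.
    destruct (Hz l k ltac:(lra)) as [H0 H1].
    apply (ode_unique _ (coef a (dX G) i l) mu); auto. apply H1.
    destruct k; [|lia]. simpl in Hk. assert (0 < a ^ 2) by (apply pow_lt; lra). nra.
Qed.

(** * Linear combinations of coordinates and the dimension count *)

Definition lincomb (n : nat) (c : nat -> R) (G : vfun) : vfun := fun x y _ => dot n c (G x y).

Lemma is_derive_dot_const n (c : nat -> R) (v : R -> nat -> R) v' t :
  (forall i, (i <= n)%nat -> is_derive (fun s => v s i) t (v' i)) ->
  is_derive (fun s => dot n c (v s)) t (dot n c v').
Proof.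
  intros Hv. replace (dot n c v') with (dot n (fun _ => 0) (v t) + dot n c v').
  - apply (is_derive_dot n (fun _ => c)); auto.
    intros i Hi. apply (is_derive_const (V := R_NormedModule) (c i)).
  - unfold dot at 1. rewrite (sum_eq _ (fun _ => 0)), sum_cte by (intros; ring). ring.
Qed.

Lemma dX_lincomb n c G : smooth_on n G -> dX (lincomb n c G) = lincomb n c (dX G).
Proof.
  intros H. extensionality x. extensionality y. extensionality j.
  apply is_derive_unique. apply (is_derive_dot_const n c (fun t => G t y)).
  intros i Hi. now apply (is_derive_dX n).
Qed.

Lemma dY_lincomb n c G : smooth_on n G -> dY (lincomb n c G) = lincomb n c (dY G).
Proof.
  intros H. extensionality x. extensionality y. extensionality j.
  apply is_derive_unique. apply (is_derive_dot_const n c (fun t => G x t)).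
  intros i Hi. now apply (is_derive_dY n).
Qed.

Lemma iterD_lincomb n c G w : smooth_on n G -> iterD w (lincomb n c G) = lincomb n c (iterD w G).
Proof.
  intros H. induction w as [|b w IH]; [reflexivity|]. simpl. rewrite IH.
  destruct b; [apply dX_lincomb | apply dY_lincomb]; now apply smooth_iterD.
Qed.

Lemma smooth_lincomb n c G m : smooth_on n G -> smooth_on m (lincomb n c G).
Proof.
  intros H w j _ x y. rewrite iterD_lincomb by auto. unfold lincomb.
  assert (Hw := smooth_iterD n G w H). split; [|split].
  - eexists. apply (is_derive_dot_const n c (fun t => iterD w G t y)).
    intros i Hi. now apply (is_derive_dX n).
  - eexists. apply (is_derive_dot_const n c (fun t => iterD w G x t)).
    intros i Hi. now apply (is_derive_dY n).
  - assert (Hc : forall i, (i <= n)%nat ->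
      continuous (fun p : R * R => iterD w G (fst p) (snd p) i) (x, y))
      by (intros i Hi; apply (H w i Hi x y)).
    clear -Hc. unfold dot. induction n as [|n IH]; simpl.
    + apply (continuous_mult (K := R_AbsRing) (fun _ => c 0%nat)); [apply continuous_const | auto].
    + apply (continuous_plus (V := R_NormedModule)); [apply IH; auto|].
      apply (continuous_mult (K := R_AbsRing) (fun _ => c (S n))); [apply continuous_const | auto].
Qed.

Lemma coef_lincomb n a c G j l x : smooth_on n G ->
  coef a (lincomb n c G) j l x = sum_f_R0 (fun i => coef a G i l x * c i) n.
Proof.
  intros H. unfold coef, lincomb, dot.
  assert (Hc : forall i, (i <= n)%nat -> forall y,
    continuous (fun t => G x t i * cas (IZR l / a * t)) y)
    by (intros; now apply (continuous_coef_integrand n)).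
  clear H. induction n as [|n IH]; simpl.
  - rewrite (RInt_comb _ _ _ (c 0%nat) 0 _ _ (Hc 0%nat ltac:(lia)) (Hc 0%nat ltac:(lia)))
      by (intros; ring).
    rewrite Rmult_0_l, Rplus_0_r. apply Rmult_comm.
  - rewrite (RInt_comb (fun y => sum_f_R0 (fun i => c i * G x y i) n * cas (IZR l / a * y))
      (fun y => G x y (S n) * cas (IZR l / a * y)) _ 1 (c (S n))).
    + rewrite IH by auto. ring.
    + clear IH. intros y.
      induction n as [|n IHn]; simpl.
      * apply (continuous_ext (fun y => c 0%nat * (G x y 0%nat * cas (IZR l / a * y)))).
        { intros; simpl; ring. }
        apply (continuous_Rmult (fun _ => c 0%nat)); [apply continuous_const | apply Hc; lia].
      * apply (continuous_ext (fun y => sum_f_R0 (fun i => c i * G x y i) n * cas (IZR l / a * y)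
          + c (S n) * (G x y (S n) * cas (IZR l / a * y)))).
        { intros; simpl; ring. }
        apply (continuous_plus (V := R_NormedModule)).
        -- apply IHn. intros; apply Hc; lia.
        -- apply (continuous_Rmult (fun _ => c (S n))); [apply continuous_const | apply Hc; lia].
    + auto.
    + intros; ring.
Qed.

Lemma periodic_dX a n F : smooth_on n F -> lattice_periodic a n F -> lattice_periodic a n (dX F).
Proof.
  intros Hs Hp x y i Hi. split.
  - apply (periodic_derive (fun t => F t y i) (fun t => dX F t y i)).
    + intros t. now apply (is_derive_dX n).
    + intros t. now apply (Hp t y i).
  - apply Derive_ext. intros t. now apply (Hp t y i).
Qed.

Lemma periodic_dY a n F : smooth_on n F -> lattice_periodic a n F -> lattice_periodic a n (dY F).
Proof.
  intros Hs Hp x y i Hi. split.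
  - apply Derive_ext. intros t. now apply (Hp x t i).
  - apply (periodic_derive (fun t => F x t i) (fun t => dY F x t i)).
    + intros t. now apply (is_derive_dY n).
    + intros t. now apply (Hp x t i).
Qed.

Lemma periodic_lin a n U V c d : lattice_periodic a n U -> lattice_periodic a n V ->
  lattice_periodic a n (lin c U d V).
Proof.
  intros HU HV x y i Hi. unfold lin.
  destruct (HU x y i Hi) as [-> ->]. destruct (HV x y i Hi) as [-> ->]. auto.
Qed.

Lemma periodic_tens a n F : smooth_on n F -> lattice_periodic a n F -> lattice_periodic a n (tens F).
Proof.
  intros Hs Hp. apply periodic_lin; auto. rewrite lap_as_lin.
  apply periodic_lin; [apply periodic_dX, periodic_dX | apply periodic_dY, periodic_dY];
    auto using smooth_dX, smooth_dY.
Qed.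

(** If [lam a^2] were not a sum of two squares, the condition on initial data in
    [eigenfunction_zero] would be vacuous and [G] would vanish. *)
Lemma eigenvalue_in_spectrum a n G lam : 0 < a -> smooth_on n G -> lattice_periodic a n G ->
  (forall i, (i <= n)%nat -> forall x y, lap G x y i = - lam * G x y i) ->
  (exists x y i, (i <= n)%nat /\ G x y i <> 0) ->
  exists p q : nat, lam * a ^ 2 = INR (p * p + q * q).
Proof.
  intros Ha Hs Hp Hlap [x [y [i [Hi Hne]]]]. apply NNPP. intros Hno. apply Hne.
  apply (eigenfunction_zero n a G i lam); auto.
  intros l k Hk. exfalso. apply Hno. exists k, (Z.abs_nat l).
  rewrite plus_INR, !mult_INR, Hk, (INR_IZR_INZ (Z.abs_nat l)), Zabs2Nat.id_abs.
  rewrite <- !mult_IZR. do 2 f_equal. nia.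
Qed.

(* The [l]-th coefficient solves [g'' = - (k / a)^2 g], hence is determined by [g 0] and [g' 0]:
   the vector [(k, l)] records the former, [(- k, l)] the latter (for [k = 0] periodicity makes
   [g] constant). *)
Definition mode (a : R) (G : vfun) (v : Z * Z) (i : nat) : R :=
  if (0 <=? fst v)%Z then coef a G i (snd v) 0 else coef a (dX G) i (snd v) 0.

(** For given [G], the relation [c . G = 0] thus follows from [r2 N] linear equations on [c], one
    per lattice point of the circle. *)
Lemma lincomb_zero_of_modes a n G c N : 0 < a -> smooth_on n G -> lattice_periodic a n G ->
  (forall i, (i <= n)%nat -> forall x y, lap G x y i = - (INR N / a ^ 2) * G x y i) ->
  (forall v, In v (reps N) -> sum_f_R0 (fun i => mode a G v i * c i) n = 0) ->
  forall x y, dot n c (G x y) = 0.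
Proof.
  intros Ha Hs Hp Hlap Hm x y.
  assert (HX := smooth_dX n G Hs). assert (HY := smooth_dY n G Hs).
  (* [lincomb] ignores its index: it is a scalar function, for which the single coordinate 0
     serves. *)
  apply (eigenfunction_zero 0 a (lincomb n c G) 0 (INR N / a ^ 2)); auto.
  - now apply smooth_lincomb.
  - intros u v. unfold lincomb. split; apply dot_ext; auto; intros i Hi; now apply (Hp u v i).
  - intros u v. unfold lap.
    rewrite !dX_lincomb, !dY_lincomb by auto. unfold lincomb.
    rewrite (dot_sym n c), (dot_sym n c (dY (dY G) u v)), <- dot_lap_l.
    rewrite (dot_ext n _ (fun i => - (INR N / a ^ 2) * G u v i + 0 * G u v i) _ c); auto.
    + rewrite dot_lin_l, (dot_sym n c). ring.
    + intros i Hi. rewrite Hlap by auto. ring.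
  - intros l k Hk.
    assert (HN : (Z.of_nat k * Z.of_nat k + l * l = Z.of_nat N)%Z).
    { apply eq_IZR. rewrite plus_IZR, !mult_IZR, <- !INR_IZR_INZ, <- Hk. field. lra. }
    split.
    + rewrite coef_lincomb by auto. refine (eq_trans _ (Hm (Z.of_nat k, l) (proj2 (in_reps _ _ _) HN))).
      apply sum_eq. intros i Hi. unfold mode. simpl.
      destruct (Z.leb_spec 0 (Z.of_nat k)); [reflexivity | lia].
    + intros Hkpos. rewrite dX_lincomb, coef_lincomb by auto.
      refine (eq_trans _ (Hm ((- Z.of_nat k)%Z, l) _)); [|apply in_reps; lia].
      apply sum_eq. intros i Hi. unfold mode. simpl.
      destruct (Z.leb_spec 0 (- Z.of_nat k)); [lia | reflexivity].
Qed.

(** If [n + 1] exceeded [r2 N1 + r2 N2], the modes of both eigenmaps would have a common nonzero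
    kernel vector [c], and [c . F = 0] would contradict fullness. *)
Lemma spectral_necessity (a : R) (n : nat) (h : R) : 0 < a -> 0 < h < 1 -> admits_pbh_cmc a n h ->
  n <> 3%nat /\
  exists p1 q1 p2 q2 : nat,
    2 * (1 - h) * a ^ 2 = INR (p1 * p1 + q1 * q1) /\
    2 * (1 + h) * a ^ 2 = INR (p2 * p2 + q2 * q2) /\
    (n + 1 <= r2 (p1 * p1 + q1 * q1) + r2 (p2 * p2 + q2 * q2))%nat.
Proof.
  intros Ha Hh [F [[Hs [Hp [Hsph [Hiso Hfull]]]] [[Hbi _] Hcmc]]].
  split.
  { intros ->. assert (H := no_flat_cmc_biharmonic_S3 F h Hs Hsph Hiso Hbi Hcmc). lra. }
  assert (HG := eigen_components n F h Hs Hsph Hiso Hbi Hcmc).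
  set (G := fun s => lin 1 (tens F) (2 * s) F).
  assert (GS : forall s, s * s = h * h -> smooth_on n (G s)) by (intros s Hsh; apply (HG s Hsh)).
  assert (GL : forall s, s * s = h * h -> forall i, (i <= n)%nat -> forall x y,
    lap (G s) x y i = - (2 * (1 - s)) * G s x y i) by (intros s Hsh; apply (HG s Hsh)).
  assert (GP : forall s, lattice_periodic a n (G s)).
  { intros s. apply periodic_lin; auto. now apply periodic_tens. }
  assert (Spec : forall s, s * s = h * h ->
    exists p q : nat, 2 * (1 - s) * a ^ 2 = INR (p * p + q * q)).
  { intros s Hsh. apply (eigenvalue_in_spectrum a n (G s)); auto.
    apply NNPP. intros Hno.
    (* [G s] is not identically zero because its product with [F] is [2 s]. *)
    assert (H0 : dot n (G s 0 0) (F 0 0) = 0).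
    { unfold dot. rewrite (sum_eq _ (fun _ => 0)), sum_cte; [ring|].
      intros i Hi. replace (G s 0 0 i) with 0; [ring|].
      apply NNPP. intros Hne. apply Hno. exists 0, 0, i. auto. }
    assert (H1 : dot n (G s 0 0) (F 0 0) = 2 * s) by apply (HG s Hsh). nra. }
  assert (Hmh : - h * - h = h * h) by ring.
  destruct (Spec h eq_refl) as [p1 [q1 E1]]. destruct (Spec (- h) Hmh) as [p2 [q2 E2]].
  exists p1, q1, p2, q2. split; auto.
  split; [rewrite <- E2; ring|].
  set (N1 := (p1 * p1 + q1 * q1)%nat) in *. set (N2 := (p2 * p2 + q2 * q2)%nat) in *.
  apply Nat.nlt_ge. intros Hlt.
  set (l1 := reps N1). set (l2 := reps N2).
  assert (R1 : r2 N1 = length l1) by reflexivity.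
  assert (R2 : r2 N2 = length l2) by reflexivity.
  set (d := (0%Z, 0%Z)).
  destruct (exists_nontrivial_kernel (length l1 + length l2) n
    (fun j i => if (j <? length l1)%nat then mode a (G h) (nth j l1 d) i
                else mode a (G (- h)) (nth (j - length l1) l2 d) i))
    as [c [[i0 [Hi0 Hc0]] Hc]]; [lia|].
  assert (Hl : forall s N, 2 * (1 - s) * a ^ 2 = INR N -> s * s = h * h ->
    forall i, (i <= n)%nat -> forall x y, lap (G s) x y i = - (INR N / a ^ 2) * G s x y i).
  { intros s N HN Hsh i Hi x y. rewrite GL by auto. rewrite <- HN. field. lra. }
  assert (Z1 : forall x y, dot n c (G h x y) = 0).
  { apply (lincomb_zero_of_modes a n (G h) c N1); auto.
    intros v Hv. destruct (In_nth l1 v d Hv) as [j [Hj <-]].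
    refine (eq_trans _ (Hc j ltac:(lia))). apply sum_eq. intros i Hi.
    destruct (Nat.ltb_spec j (length l1)); [reflexivity | lia]. }
  assert (Z2 : forall x y, dot n c (G (- h) x y) = 0).
  { apply (lincomb_zero_of_modes a n (G (- h)) c N2); auto.
    intros v Hv. destruct (In_nth l2 v d Hv) as [j [Hj <-]].
    refine (eq_trans _ (Hc (length l1 + j)%nat ltac:(lia))). apply sum_eq. intros i Hi.
    destruct (Nat.ltb_spec (length l1 + j) (length l1)); [lia|].
    now replace (length l1 + j - length l1)%nat with j by lia. }
  (* [G h - G (- h) = 4 h F], so [c] annihilates [F]. *)
  apply Hc0. apply (Hfull c); auto. intros x y.
  specialize (Z1 x y). specialize (Z2 x y). unfold G, lin in Z1, Z2.
  rewrite dot_sym, dot_lin_l in Z1, Z2. rewrite dot_sym. nra.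
Qed.

Theorem theorem3p8 :
  (forall (a : R) (n : nat) (h : R),
     0 < a -> (n mod 4 = 3)%nat -> 0 < h < 1 ->
     (admits_pbh_cmc a n h <->
      exists p1 q1 p2 q2 : nat,
        (0 < p1 * p1 + q1 * q1)%nat /\ (p1 * p1 + q1 * q1 < p2 * p2 + q2 * q2)%nat /\
        4 * a ^ 2 = INR (p1 * p1 + q1 * q1 + p2 * p2 + q2 * q2) /\
        h = (INR (p2 * p2 + q2 * q2) - INR (p1 * p1 + q1 * q1))
            / INR (p1 * p1 + q1 * q1 + p2 * p2 + q2 * q2) /\
        (7 <= n)%nat /\ (n <= r2 (p1 * p1 + q1 * q1) + r2 (p2 * p2 + q2 * q2) - 1)%nat))
  /\
  (forall (a : R) (p q : nat),
     0 < a -> (0 < p)%nat -> (p < q)%nat -> 4 * a ^ 2 = INR (p * p + q * q) ->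
     forall n : nat, Nat.odd n = true -> (5 <= n)%nat ->
       (n <= r2 (p * p) + r2 (q * q) - 1)%nat ->
       admits_pbh_cmc a n ((INR (q * q) - INR (p * p)) / INR (p * p + q * q))).
Proof.
  split.
  - intros a n h Ha Hn Hh.
    assert (Ha2 : 0 < a ^ 2) by (apply pow_lt; lra).
    split.
    + intros Hadm. destruct (spectral_necessity a n h Ha Hh Hadm) as [Hn3 [p1 [q1 [p2 [q2 [E1 [E2 Hr]]]]]]].
      assert (Hsum : (p1 * p1 + q1 * q1 + p2 * p2 + q2 * q2
        = (p1 * p1 + q1 * q1) + (p2 * p2 + q2 * q2))%nat) by lia.
      exists p1, q1, p2, q2. rewrite !Hsum, plus_INR, <- E1, <- E2.
      split; [|split; [|split; [|split; [|split]]]].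
      (* The two sums of squares are proportional to [1 - h] and [1 + h]: [h < 1] makes the smaller
         positive, [h > 0] makes them distinct. *)
      * apply INR_lt. rewrite <- E1. simpl INR at 1. nra.
      * apply INR_lt. rewrite <- E1, <- E2. nra.
      * ring.
      * field. lra.
      (* The only value below 7 congruent to 3 modulo 4 is 3, which is excluded. *)
      * assert (Hdm := Nat.div_mod_eq n 4). lia.
      * lia.
    + intros [p1 [q1 [p2 [q2 [H0 [H1 [E [-> [H7 Hr]]]]]]]]].
      rewrite <- Nat.add_assoc in *.
      apply admits_of_two_circles; auto; apply quad_nonempty; lia.
  - intros a p q Ha Hp Hpq E n Hodd Hn Hr. now apply admits_of_squares.
Qed.
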